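(* There is a positive universal constant $C$ such that the following holds. Fix $\gamma > 0$ and $\varepsilon \in (0,1)$. There exist a positive integer $m = m(\gamma,\varepsilon)$ and a threshold $N(\gamma,\varepsilon)$, depending only on $\gamma$ and $\varepsilon$, such that for all $n \ge N(\gamma,\varepsilon)$ the following statement holds. Suppose that $A = (a_{jk})$ is an $n \times n$ matrix with $\|A\| = 1$ and uniformly bounded entries: $$|a_{jk}| \le \frac{1}{(\log n)^{1+\gamma}} \qquad \text{for } j,k = 1,2,\dots,n.$$ Then there is a partition of the set $\{1,2,\dots,n\}$ into $m$ blocks $\{\sigma_1,\sigma_2,\dots,\sigma_m\}$ such that $$\Big\| \sum_{j=1}^m P_{\sigma_j} A P_{\sigma_j} \Big\| \le \varepsilon.$$ Moreover, the number $m$ satisfies the bound $$m \le C\, \varepsilon^{-C/\min\{1,\gamma\}}.$$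
   Context: Matrices have complex entries (real matrices are included). $\|\cdot\|$ denotes the spectral norm, i.e. the operator norm of a matrix as a linear map from $\ell_2^n$ to $\ell_2^n$. For $\sigma \subseteq \{1,\dots,n\}$, $P_\sigma$ denotes the diagonal projector onto the coordinates listed in $\sigma$, i.e. the $n\times n$ diagonal matrix whose $i$-th diagonal entry is $1$ if $i \in \sigma$ and $0$ otherwise. $\log$ is the natural logarithm. *)

(* Defs.v *)
From HB Require Import structures.
From mathcomp Require Import all_boot all_order all_algebra.
From mathcomp Require Import complex.
From mathcomp Require Import all_classical all_reals all_analysis.

Set Implicit Arguments.
Unset Strict Implicit.
Unset Printing Implicit Defensive.

Import Order.TTheory GRing.Theory Num.Theory.

Local Open Scope classical_set_scope.
Local Open Scope complex_scope.
Local Open Scope ring_scope.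

(* [normc] is the real-valued modulus on [R[i]]; the generic norm [`|z|] takes
   its values in [R[i]]. *)
Definition l2norm (R : realType) (n : nat) (x : 'cV[R[i]]_n) : R :=
  Num.sqrt (\sum_(i < n) ComplexField.Normc.normc (x i 0) ^+ 2).

Definition specnorm (R : realType) (n : nat) (A : 'M[R[i]]_n) : R :=
  sup [set l2norm (A *m x) | x in [set x | l2norm x <= 1]].

Definition coordproj (R : realType) (n : nat) (s : {set 'I_n}) : 'M[R[i]]_n :=
  diag_mx (\row_(i < n) (i \in s)%:R).
Arguments coordproj : clear implicits.

(* Main.v *)
Require Import Defs.
From HB Require Import structures.
From mathcomp Require Import all_boot all_order all_algebra.
From mathcomp Require Import complex.
From mathcomp Require Import all_classical all_reals all_analysis.
From mathcomp Require Import ring lra.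

Set Implicit Arguments.
Unset Strict Implicit.
Unset Printing Implicit Defensive.

Import Order.TTheory GRing.Theory Num.Theory.

Local Open Scope complex_scope.
Local Open Scope ring_scope.

(** The bound on the entries makes every diagonal entry of [A] at most
    [eps / 4] in modulus once [ln n >= 4 / eps].  What is left has zero
    diagonal, and a contraction with zero diagonal can be paved, with norm at
    most [eps] and a number of blocks polynomial in [1 / eps], uniformly in the
    dimension.  This is the Anderson paving theorem of Marcus, Spielman and
    Srivastava; the proof below follows the mixed determinants of Leake and
    Ravichandran, with two colours, so that each step involves only a quadratic
    polynomial.

    Reduction to forms.  A matrix is controlled through its numerical range
    ([numerical_radius_bound]), so it is enough to pave its Hermitian and its
    anti-Hermitian part and to take the common refinement ([pave_contraction]).
    For a Hermitian matrix with zero diagonal, one round with 400 colours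
    multiplies the size of the quadratic form by [9 / 10] ([paving_round]), and
    rounds are iterated on the pinched matrix ([paving_rounds]): [400 ^ t]
    colours give the factor [(9 / 10) ^+ t], which is the polynomial bound.

    One round.  Colouring with 100 colours so that no single change of colour
    decreases the weight inside the classes divides the squared norm of every
    row by 100 ([unfriendly_colouring]).  After that, two colours bring the
    largest eigenvalue from 1 to [9 / 10] ([two_colour]); doing this for the
    matrix and for its opposite uses [100 * 2 * 2] colours.

    Two colours.  Let [B] be the block diagonal matrix of two copies of the
    given matrix.  A two-colouring selects a set [T] that contains one index of
    each pair (k, k + n), and the largest eigenvalues of both colour classes
    are below [x] as soon as [det (z - B)_T] is positive for all [z >= x].  Let
    [mixdet] be the sum of these determinants over all the choices.  It does
    not vanish when all the variables have positive imaginary part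
    ([mixdet_stable]); at real points this gives Rayleigh's inequality
    [f * f_cd <= f_c * f_d] for the partial derivatives
    ([rayleigh_pair_rdet]).  Two consequences of that inequality finish the
    proof.
    - If the sum over the choices is positive above [x], then so is one of its
      two halves, for any pair ([interlacing]).  Hence positivity of the whole
      sum gives it for some [T] ([select_colours]).
    - Summing over the choice in one pair allows both of its variables to be
      lowered by a constant, while the logarithmic derivatives in the variables
      still to be treated do not increase ([barrier_pos], [barrier_dec]).
      These derivatives start as the diagonal entries of the resolvent at
      [21 / 20], which are at most [5 / 4] because the rows are short
      ([resolvent_bound]); so every variable comes down by [1 / 5], below
      [9 / 10] ([barrier]). *)

(** * Determinants of principal submatrices and their sums over choices *)

Definition upd (N : nat) (T : Type) (z : 'I_N -> T) (d : 'I_N) (t : T) :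
  'I_N -> T := fun i => if i == d then t else z i.

Section Pencil.
Variables (K : comNzRingType) (N : nat) (A : 'M[K]_N).
Implicit Types (S : {set 'I_N}) (z : 'I_N -> K) (U : seq ('I_N * 'I_N)).

(** The principal submatrix of [diag z - A] on [S], padded by the identity: all
    index sets then share one matrix type, and the determinant is unchanged. *)
Definition pencil S z : 'M[K]_N :=
  \matrix_(i, j) (if (i \in S) && (j \in S) then z i *+ (i == j) - A i j
                  else (i == j)%:R).

(** Each pair in [U] stands for an index whose colour is not yet decided: its
    two components are the copies of that index, and exactly one of them joins
    [S]. The recursion exposes one pair at a time, which is how both the
    interlacing and the barrier argument proceed. *)
Fixpoint mixdet U S z : K :=
  if U is ab :: U' then mixdet U' (ab.1 |: S) z + mixdet U' (ab.2 |: S) z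
  else \det (pencil S z).

Lemma cofactor_pencil S z c t : c \in S ->
  cofactor (pencil S (upd z c t)) c c = \det (pencil (S :\ c) z).
Proof.
move=> cS; rewrite (expand_det_row _ c) (bigD1 c) //= big1 ?addr0; last first.
  by move=> j jc;
    rewrite !mxE !inE eqxx /= (negbTE (_ : c != j)) ?mul0r // eq_sym.
rewrite !mxE !inE eqxx /= mul1r /cofactor; congr (_ * \det _).
apply/matrixP => i j; rewrite !mxE !inE /upd.
by rewrite !(eq_sym _ c) !(negbTE (neq_lift _ _)).
Qed.

(** Only the entry [(c, c)] contains [z c], so differentiating in [z c] erases
    the row and the column [c]. *)
Lemma det_pencil_affine S z c : c \in S ->
  \det (pencil S z) =
    z c * \det (pencil (S :\ c) z) + \det (pencil S (upd z c 0)).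
Proof.
move=> cS; rewrite -(cofactor_pencil z (z c) cS).
have updE : upd z c (z c) =1 z by move=> i; rewrite /upd; case: eqP => [->|].
have -> : pencil S (upd z c (z c)) = pencil S z.
  by apply/matrixP => i j; rewrite !mxE updE.
have expd M : \det M = M c c * cofactor M c c
    + \sum_(j < N | j != c) M c j * cofactor M c j :> K.
  by rewrite (expand_det_row _ c) (bigD1 c).
have cofE j : cofactor (pencil S z) c j = cofactor (pencil S (upd z c 0)) c j.
  rewrite /cofactor; congr (_ * \det _); apply/matrixP => i k;
    rewrite !mxE /upd.
  by rewrite (eq_sym _ c) (negbTE (neq_lift _ _)).
rewrite (expd (pencil S z)) (expd (pencil S (upd z c 0))) addrA -!cofE -mulrDl.
congr (_ + _); first by rewrite !mxE cS /upd !eqxx /=; congr (_ * _); ring.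
apply: eq_bigr => j jc; rewrite cofE; congr (_ * _).
by rewrite !mxE /upd eqxx (negbTE (_ : c != j)) ?mulr0n // eq_sym.
Qed.

Lemma det_pencil_indep S z c t : c \notin S ->
  \det (pencil S (upd z c t)) = \det (pencil S z).
Proof.
move=> cS; congr (\det _); apply/matrixP => i j; rewrite !mxE /upd.
by case: ifP => // /andP[iS _]; case: eqP => // ic; rewrite -ic iS in cS.
Qed.

Definition vars U := [seq ab.1 | ab <- U] ++ [seq ab.2 | ab <- U].

Lemma mem_vars ab U c : (c \in vars (ab :: U)) =
  [|| c == ab.1, c == ab.2 | c \in vars U].
Proof.
by rewrite /vars !mem_cat /= !inE; do !case: (_ == _) => //=; rewrite ?orbT.
Qed.

Lemma setU1D1 S a c : a != c -> (a |: S) :\ c = a |: (S :\ c).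
Proof. by move=> ac; rewrite finset.setDUl; congr (_ :|: _);
  apply/finset.setDidPl; rewrite disjoints1 inE. Qed.

Lemma mixdet_affine U S z c : c \in S -> c \notin vars U ->
  mixdet U S z = z c * mixdet U (S :\ c) z + mixdet U S (upd z c 0).
Proof.
elim: U S => [|[a b] U IH] S cS /=; first by move=> _; exact: det_pencil_affine.
rewrite mem_vars /= !negb_or => /and3P[ca cb cU].
rewrite (IH (a |: S)) ?(IH (b |: S)) ?inE ?cS ?orbT //.
by rewrite !setU1D1 1?eq_sym //; ring.
Qed.

Lemma mixdet_indep U S z c t : c \notin S -> c \notin vars U ->
  mixdet U S (upd z c t) = mixdet U S z.
Proof.
elim: U S => [|[a b] U IH] S cS /=; first by move=> _; exact: det_pencil_indep.
rewrite mem_vars /= !negb_or => /and3P[ca cb cU].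
by rewrite !IH // !inE negb_or ?ca ?cb.
Qed.

Lemma updd z c t : upd z c t c = t. Proof. by rewrite /upd eqxx. Qed.

Lemma eq_mixdet U S z z' : z =1 z' -> mixdet U S z = mixdet U S z'.
Proof.
move=> zz'; elim: U S => [|[a b] U IH] S /=; last by rewrite !IH.
by congr (\det _); apply/matrixP => i j; rewrite !mxE zz'.
Qed.

Lemma upd_upd z c s t : upd (upd z c s) c t =1 upd z c t.
Proof. by move=> i; rewrite /upd; case: eqP. Qed.

Lemma upd_id z c : upd z c (z c) =1 z.
Proof. by move=> i; rewrite /upd; case: eqP => [->|]. Qed.

Lemma updC z c d s t : c != d -> upd (upd z c s) d t =1 upd (upd z d t) c s.
Proof. by move=> cd i; rewrite /upd; case: eqP => // ->;
  rewrite eq_sym (negbTE cd). Qed.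

Lemma mixdet_upd U S z c w : c \notin S -> c \notin vars U ->
  mixdet U (c |: S) (upd z c w) =
    w * mixdet U S z + mixdet U (c |: S) (upd z c 0).
Proof.
move=> cS cU; rewrite (@mixdet_affine _ _ _ c) ?setU11 // updd setU1K //.
by rewrite mixdet_indep // (eq_mixdet _ _ (upd_upd _ _ _ _)).
Qed.

(** Here [d] may also belong to a pair of [U], where the derivative is no longer
    a [mixdet] with [d] removed from the index set. *)
Lemma mixdet_affine_any U S z d t :
  mixdet U S (upd z d t) = mixdet U S (upd z d 0)
     + t * (mixdet U S (upd z d 1) - mixdet U S (upd z d 0)).
Proof.
elim: U S => [|[a b] U IH] S /=; last by rewrite 2!IH; ring.
have [dS|dS] := boolP (d \in S); last by rewrite !det_pencil_indep //; ring.
have E s : \det (pencil S (upd z d s)) =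
    s * \det (pencil (S :\ d) z) + \det (pencil S (upd z d 0)).
  rewrite (det_pencil_affine _ dS) updd det_pencil_indep ?inE ?eqxx //.
  by congr (_ + \det _); apply/matrixP => i j; rewrite !mxE upd_upd.
by rewrite (E t) (E 1); ring.
Qed.

End Pencil.

Lemma map_pencil (K L : comNzRingType) (f : {rmorphism K -> L}) N (A :
  'M[K]_N) S z :
  map_mx f (pencil A S z) = pencil (map_mx f A) S (f \o z).
Proof.
apply/matrixP => i j; rewrite !mxE; case: ifP => _; last by rewrite rmorph_nat.
by rewrite rmorphB rmorphMn.
Qed.

(** Used for complex conjugation and for evaluating at a point a [mixdet] whose
    variables move along a line, seen as a polynomial. *)
Lemma map_mixdet (K L : comNzRingType) (f : {rmorphism K -> L}) N (A :
  'M[K]_N) U S z :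
  f (mixdet A U S z) = mixdet (map_mx f A) U S (f \o z).
Proof.
elim: U S => [|[a b] U IH] S /=; last by rewrite rmorphD !IH.
by rewrite -det_map_mx map_pencil.
Qed.

(** * Hermitian forms *)

Section Forms.
Variable R : rcfType.
Local Open Scope complex_scope.
Local Notation C := R[i].
Local Notation Re := (@complex.Re R).
Local Notation Im := (@complex.Im R).

Definition hdot n (u v : 'cV[C]_n) : C := \sum_i (u i 0)^* * v i 0.

Definition nsq n (v : 'cV[C]_n) :
  R := \sum_i (Re (v i 0) ^+ 2 + Im (v i 0) ^+ 2).

Definition qf n (A : 'M[C]_n) (v : 'cV[C]_n) : R := Re (hdot v (A *m v)).

Definition herm n (A : 'M[C]_n) := forall i j, A j i = (A i j)^*.

Lemma ReD (x y : C) : Re (x + y) = Re x + Re y. Proof. by case: x; case: y. Qed.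
Lemma ImD (x y : C) : Im (x + y) = Im x + Im y. Proof. by case: x; case: y. Qed.
Lemma ReM (x y : C) : Re (x * y) = Re x * Re y - Im x * Im y.
Proof. by case: x; case: y. Qed.
Lemma ImM (x y : C) : Im (x * y) = Re x * Im y + Im x * Re y.
Proof. by case: x; case: y. Qed.
Lemma ReJ (x : C) : Re x^* = Re x. Proof. by case: x. Qed.
Lemma ImJ (x : C) : Im x^* = - Im x. Proof. by case: x. Qed.
Lemma Re_sum I r (P : pred I) (F : I -> C) :
  Re (\sum_(i <- r | P i) F i) = \sum_(i <- r | P i) Re (F i).
Proof. by apply: (big_morph _ ReD). Qed.
Lemma Im_sum I r (P : pred I) (F : I -> C) :
  Im (\sum_(i <- r | P i) F i) = \sum_(i <- r | P i) Im (F i).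
Proof. by apply: (big_morph _ ImD). Qed.

Lemma eqC (x y : C) : Re x = Re y -> Im x = Im y -> x = y.
Proof. by case: x; case: y => /= a b c d -> ->. Qed.

Lemma real_of_conj (x : C) : x^* = x -> x = (Re x)%:C.
Proof. by case: x => a b [] /= h; congr (_ +i* _); lra. Qed.

Lemma hdotC n (u v : 'cV[C]_n) : hdot v u = (hdot u v)^*.
Proof. by rewrite /hdot rmorph_sum; apply: eq_bigr => i _;
  rewrite rmorphM /= conjcK mulrC. Qed.

Lemma hdot_herm n (A : 'M[C]_n) u v :
  herm A -> hdot u (A *m v) = hdot (A *m u) v.
Proof.
move=> hA; rewrite /hdot.
under eq_bigr do rewrite mxE mulr_sumr.
rewrite exchange_big; apply: eq_bigr => j _; rewrite !mxE rmorph_sum mulr_suml.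
by apply: eq_bigr => i _; rewrite (hA j i) rmorphM /=; ring.
Qed.

Lemma hdot_self n (v : 'cV[C]_n) : hdot v v = (nsq v)%:C.
Proof.
apply: eqC; rewrite /hdot /nsq ?Re_sum ?Im_sum /=.
  by apply: eq_bigr => i _; rewrite ReM ReJ ImJ; ring.
by apply: big1 => i _; rewrite ImM ReJ ImJ; ring.
Qed.

Lemma qf_real n (A : 'M[C]_n) v : herm A -> hdot v (A *m v) = (qf A v)%:C.
Proof. by move=> hA; apply: real_of_conj; rewrite -hdotC -hdot_herm. Qed.

Lemma nsq_ge0 n (v : 'cV[C]_n) : 0 <= nsq v.
Proof. by apply: sumr_ge0 => i _; rewrite addr_ge0 ?sqr_ge0. Qed.

Lemma nsq_eq0 n (v : 'cV[C]_n) : nsq v = 0 -> v = 0.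
Proof.
move=> /eqP; rewrite psumr_eq0 => [/allP h|i _];
  last by rewrite addr_ge0 ?sqr_ge0.
apply/matrixP => i j; rewrite ord1 mxE; have := h i (mem_index_enum _).
by rewrite /= paddr_eq0 ?sqr_ge0 // !sqrf_eq0 => /andP[/eqP a /eqP b];
  apply: eqC.
Qed.

(** * Stability: no zeros with all variables in the upper half-plane *)

Section Stable.
Variables (N : nat) (A : 'M[C]_N).
Hypothesis hA : herm A.
Implicit Types (S : {set 'I_N}) (z : 'I_N -> C) (x y : 'I_N -> R)
  (U : seq ('I_N * 'I_N)).

(** A kernel vector lives on [S], because the rows outside [S] are those of the
    identity; pairing it with the equation [z v = A v] on [S] gives the
    identity. *)
Lemma pencil_kernel S z : \det (pencil A S z) = 0 ->
  exists v : 'cV[C]_N, [/\ v != 0, forall i, i \notin S -> v i 0 = 0 &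
    \sum_i z i * ((v i 0)^* * v i 0) = (qf A v)%:C].
Proof.
rewrite -det_tr => /eqP/det0P[w w0 wM].
have [v v_neq0 Mv] : exists2 v : 'cV[C]_N, v != 0 & pencil A S z *m v = 0.
  exists w^T; first by rewrite -(inj_eq trmx_inj) trmxK trmx0.
  by apply: trmx_inj; rewrite trmx_mul trmxK trmx0.
have vi i : \sum_j pencil A S z i j * v j 0 = 0.
  by have /matrixP/(_ i 0) := Mv; rewrite !mxE.
exists v.
have v0 i : i \notin S -> v i 0 = 0.
  move=> iS; have := vi i; rewrite (bigD1 i) //= big1 ?addr0 => [|j ji].
    by rewrite !mxE (negbTE iS) /= eqxx mul1r.
  by rewrite !mxE (negbTE iS) /= eq_sym (negbTE ji) mul0r.
split=> //; rewrite -qf_real // /hdot; apply: eq_bigr => i _.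
have [iS|iS] := boolP (i \in S); last by rewrite v0 // rmorph0 !(mul0r, mulr0).
rewrite mulrCA; congr (_ * _); apply/eqP; rewrite -subr_eq0 mxE; apply/eqP.
apply: etrans (vi i);
  rewrite (bigD1 i) //= [in RHS](bigD1 i) //= !mxE iS /= eqxx opprD addrA.
rewrite mulr1n mulrBl; congr (_ + _); rewrite -sumrN; apply: eq_bigr => j ji.
rewrite !mxE iS /= eq_sym (negbTE ji) mulr0n sub0r.
by case: ifP => [|/negbT /v0 ->]; rewrite ?mulr0 ?oppr0 // mulNr.
Qed.

(** The form of a Hermitian matrix is real, so the imaginary part of the
    identity of [pencil_kernel] reads [\sum_i Im (z i) * |v i|^2 = 0]. *)
Lemma det_pencil_stable S z : (forall i,
  0 < Im (z i)) -> \det (pencil A S z) != 0.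
Proof.
move=> z0; apply/eqP => /pencil_kernel[v [vn0 _ /(congr1 Im)]].
rewrite Im_sum /= => /eqP.
have E i : Im (z i * ((v i 0)^* * v i 0)) =
  Im (z i) * (Re (v i 0) ^+ 2 + Im (v i 0) ^+ 2).
  by rewrite !(ReM, ImM, ReJ, ImJ); ring.
under eq_bigr do rewrite E.
rewrite psumr_eq0 => [/allP h|i _];
  last by rewrite mulr_ge0 ?addr_ge0 ?sqr_ge0 // ltW.
case/negP: vn0; apply/eqP; apply: nsq_eq0; apply: big1 => i _.
by have := h i (mem_index_enum _); rewrite /= mulf_eq0 gt_eqF //= => /eqP.
Qed.

(** Both roots have nonpositive imaginary part, and [- e / h] is their sum. *)
Lemma upper_quadratic (h e f : C) : h != 0 ->
  (forall w, 0 < Im w -> h * w ^+ 2 + e * w + f != 0) -> 0 <= Im (e / h).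
Proof.
move=> h0 H.
pose s := sqrtC ((e / h) ^+ 2 - 4 * (f / h)).
have s2 : s ^+ 2 = (e / h) ^+ 2 - 4 * (f / h) by rewrite sqrtCK.
have root (w : C) : (2 * w + e / h) ^+ 2 = s ^+ 2 -> Im w <= 0.
  move=> ws; rewrite leNgt; apply/negP => /H /eqP; apply.
  have -> : h * w ^+ 2 + e * w + f =
     h / 4 * ((2 * w + e / h) ^+ 2 - ((e / h) ^+ 2 - 4 * (f / h))) by field.
  by rewrite ws s2 subrr mulr0.
have r1 := root ((s - e / h) / 2); have r2 := root ((- s - e / h) / 2).
have {}r1 := r1 ltac:(by congr (_ ^+ 2); field).
have {}r2 := r2 ltac:(by rewrite -[in RHS]sqrrN; congr (_ ^+ 2); field).
have -> : e / h = - ((s - e / h) / 2 + (- s - e / h) / 2) by field.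
have -> (x : C) : Im (- x) = - Im x by case: x.
by rewrite ImD; lra.
Qed.

Definition fresh U S := uniq (vars U) && all (fun i => i \notin S) (vars U).

Lemma vars_cons a b U : perm_eq (vars ((a, b) :: U)) (a :: b :: vars U).
Proof. by rewrite /vars /= perm_cons -cat1s perm_catCA. Qed.

Lemma fresh_cons a b U S : fresh ((a, b) :: U) S =
  [&& a != b, a \notin S, b \notin S, a \notin vars U,
    b \notin vars U & fresh U S].
Proof.
rewrite /fresh (perm_uniq (vars_cons a b U)) (perm_all _ (vars_cons a b U))
  /= inE negb_or.
by do !case: (_ \in _); case: (a == b); rewrite ?(andbT, andbF).
Qed.

Lemma fresh_setU1 U S c : c \notin vars U -> fresh U S -> fresh U (c |: S).
Proof.
move=> cU /andP[uU /allP aU]; rewrite /fresh uU; apply/allP => i iU.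
by rewrite !inE negb_or aU // andbT; apply: contraNneq cU => <-.
Qed.

Lemma fresh_sub U S (T : {set 'I_N}) : T \subset S -> fresh U S -> fresh U T.
Proof.
move=> TS /andP[uU /allP aU]; rewrite /fresh uU; apply/allP => i iU.
by apply: contra (aU i iU); apply: (fintype.subsetP TS).
Qed.

Lemma fresh_notin U S c : fresh U S -> c \in S -> c \notin vars U.
Proof. by move=> /andP[_ /allP aU] cS; apply: contraL cS; apply: aU. Qed.

(** Write [h], [ea], [eb] as in the proof.  Setting both variables of the pair
    to [w] in the determinant that contains [a] and [b] gives a quadratic
    [h w^2 + (ea + eb) w + f] with no zero in the upper half-plane; summing
    over the choice between [a] and [b] gives [h (z a + z b) + (ea + eb)],
    which is affine with a zero governed by the sum of the roots of that
    quadratic. *)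
Lemma mixdet_stable U S z : fresh U S -> (forall i, 0 < Im (z i)) ->
  mixdet A U S z != 0.
Proof.
elim: U S z => [|[a b] U IH] S z; first by move=> _; apply: det_pencil_stable.
rewrite fresh_cons => /and5P[ab aS bS aU /andP[bU fU]] z0 /=.
have faU := fresh_setU1 aU fU; have fbU := fresh_setU1 bU fU.
have fabU := fresh_setU1 aU fbU.
set h := mixdet A U S z; have h0 : h != 0 by apply: IH.
set ea := mixdet A U (a |: S) (upd z a 0).
set eb := mixdet A U (b |: S) (upd z b 0).
have -> : mixdet A U (a |: S) z = z a * h + ea.
  by rewrite -(eq_mixdet _ _ _ (upd_id z a)) mixdet_upd.
have -> : mixdet A U (b |: S) z = z b * h + eb.
  by rewrite -(eq_mixdet _ _ _ (upd_id z b)) mixdet_upd.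
have ba : b != a by rewrite eq_sym.
pose f := mixdet A U (a |: (b |: S)) (upd (upd z b 0) a 0).
have Q w : mixdet A U (a |: (b |: S)) (upd (upd z b w) a w) =
    h * w ^+ 2 + (ea + eb) * w + f.
  rewrite (mixdet_upd _ _ _ (_ : a \notin b |: S)) ?inE ?negb_or ?ab //.
  rewrite (mixdet_upd _ _ _ bS) // (eq_mixdet _ _ _ (updC _ _ _ ba))
    finset.setUCA.
  rewrite (mixdet_upd _ _ _ (_ : b \notin a |: S)) ?inE ?negb_or ?ba //.
  rewrite finset.setUCA (eq_mixdet _ _ _ (updC _ _ _ ab)) -/h -/ea -/eb -/f;
    ring.
have wz c w u : 0 < Im w -> (forall i, 0 < Im (u i)) -> forall i,
  0 < Im (upd u c w i).
  by move=> w0 u0 i; rewrite /upd; case: ifP.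
have Ime : 0 <= Im ((ea + eb) / h).
  apply: (@upper_quadratic _ _ f) => // w w0.
  by rewrite -Q IH //; do 2! apply: (wz) => //.
have -> : z a * h + ea + (z b * h + eb) = h * (z a + z b + (ea + eb) / h).
  by field.
rewrite mulf_neq0 //; apply/eqP => /(congr1 Im); rewrite 2!ImD /=.
by have := z0 a; have := z0 b; lra.
Qed.

End Stable.
End Forms.

(** * Rayleigh's inequality at real points *)

Section RealPoints.
Variable R : rcfType.
Local Open Scope complex_scope.
Local Notation C := R[i].
Local Notation Re := (@complex.Re R).
Local Notation Im := (@complex.Im R).

Lemma norm_real (r : R) : 0 <= r -> `|r%:C| = r%:C :> C.
Proof. by move=> r0; rewrite ger0_norm // ler0c. Qed.

(** Passage from the open to the closed half-plane. *)
Lemma limit_Im_ge0 (q : {poly C}) :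
  (forall e : R, 0 < e -> 0 <= Im q.[e%:C]) -> 0 <= Im q.[0].
Proof.
move=> H; rewrite leNgt; apply/negP => q0.
have /factor_theorem[p qp] :
  root (q - q.[0]%:P) 0 by rewrite /root !hornerE subrr.
have qE x : q.[x] = q.[0] + p.[x] * x.
  by have /(congr1 (fun r => r.[x])) := qp; rewrite !hornerE subr0 => <-;
    rewrite addrC subrK.
have [u hu] := poly_disk_bound p 1.
have u0 : 0 <= u by apply: le_trans (hu 0 _); rewrite ?normr0.
have [r ur] : exists r : R, u = r%:C by exists (Re u);
  rewrite RRe_real // ger0_real.
move: u0 hu; rewrite {}ur ler0c => r0 hu.
pose e := Num.min 1 (- Im q.[0] / (2 * (r + 1))).
have e0 : 0 < e by rewrite lt_min ltr01 divr_gt0 //; lra.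
have e1 : e <= 1 by rewrite ge_min lexx.
have re : r * e < - Im q.[0].
  have : (r + 1) * e <= - Im q.[0] / 2.
    have /(ler_wpM2l (_ : 0 <= r + 1)) : e <= - Im q.[0] / (2 * (r + 1)).
      by rewrite ge_min lexx orbT.
    move=> /(_ ltac:(lra)) /le_trans; apply.
    rewrite le_eqVlt; apply/orP; left; apply/eqP; field; lra.
  by have := e0; lra.
have := H e e0; rewrite qE ImD.
have : `|p.[e%:C] * e%:C| <= (r * e)%:C.
  have -> : (r * e)%:C = r%:C * e%:C :> C by rewrite rmorphM.
  rewrite normrM (norm_real (ltW e0)); apply: ler_wpM2r;
    first by rewrite ler0c ltW.
  by apply: hu; rewrite (norm_real (ltW e0)) -[1]/(1%:C) lecR.
move=> /(le_trans _); set x := _ * _ => hx.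
have : `|Im x|%:C <= (r * e)%:C.
  apply: hx; have := normc_ge_Re (x * 'i); rewrite ReiNIm normrN normrM.
  by rewrite [X in _ * X]normc_def /= expr0n add0r expr1n sqrtr1 mulr1.
by rewrite lecR; have := ler_norm (Im x); lra.
Qed.

Section Points.
Variables (N : nat) (A : 'M[C]_N).
Hypothesis hA : herm A.
Implicit Types (S : {set 'I_N}) (z : 'I_N -> C) (x y : 'I_N -> R)
  (U : seq ('I_N * 'I_N)).

Lemma Im_mulJ (x y : C) :
  y != 0 -> Im (x * y^*) = (Re y ^+ 2 + Im y ^+ 2) * Im (x / y).
Proof.
move=> y0; have {1}-> : x = (x / y) * y by field.
by move: (x / y) => w; rewrite !(ImM, ReM, ReJ, ImJ); ring.
Qed.

(** The mixed determinant is affine in [z c] with slope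
    [mixdet A U (S :\ c) z], and its zero in [z c] cannot lie in the upper
    half-plane. *)
Lemma mixdet_ratio_open U S z c : fresh U S -> c \in S -> (forall i,
  0 < Im (z i)) ->
  0 <= Im (mixdet A U S z * (mixdet A U (S :\ c) z)^*).
Proof.
move=> fU cS z0; have cU := fresh_notin fU cS.
have f1 := fresh_sub (subsetDl S [set c]) fU.
set g := mixdet A U (S :\ c) z; have g0 : g != 0 by apply: mixdet_stable.
rewrite Im_mulJ // mulr_ge0 ?addr_ge0 ?sqr_ge0 //.
rewrite (mixdet_affine _ _ cS) // -/g; set e := mixdet _ _ _ _.
have -> : (z c * g + e) / g = z c + e / g by field.
rewrite ImD; apply: addr_ge0; first exact: ltW.
rewrite leNgt; apply/negP => eg.
have : mixdet A U S (upd z c (- (e / g))) != 0.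
  apply: mixdet_stable => // i; rewrite /upd; case: ifP => // _.
  by move: eg; case: (e / g) => p q /=; lra.
have cS1 : c \notin S :\ c by rewrite !inE eqxx.
rewrite (mixdet_affine _ _ cS) // updd (mixdet_indep _ _ _ cS1) //.
rewrite (eq_mixdet _ _ _ (upd_upd _ _ _ _)) -/e -/g => /eqP; apply.
by field.
Qed.

Lemma mixdet_poly U S (z v : 'I_N -> C) : exists p : {poly C},
  forall e, p.[e] = mixdet A U S (fun i => z i + v i * e).
Proof.
exists (mixdet (map_mx polyC A) U S (fun i => (z i)%:P + (v i)%:P * 'X)) => e.
rewrite -[LHS]/(horner_eval e _) map_mixdet -map_mx_comp.
have -> : map_mx (horner_eval e \o polyC) A = A.
  by apply/matrixP => i j; rewrite mxE /= /horner_eval hornerC.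
by apply: eq_mixdet => i; rewrite /= /horner_eval !hornerE.
Qed.

(** Shift all the variables by [e 'i] and let [e] tend to 0; on real [e] the
    conjugate of a polynomial is the polynomial with conjugate coefficients. *)
Lemma mixdet_ratio_closed U S z c : fresh U S -> c \in S -> (forall i,
  0 <= Im (z i)) ->
  0 <= Im (mixdet A U S z * (mixdet A U (S :\ c) z)^*).
Proof.
move=> fU cS z0.
have [p hp] := mixdet_poly U S z (fun=> 'i).
have [q hq] := mixdet_poly U (S :\ c) z (fun=> 'i).
have E (e : R) : (p * map_poly (@conjc R) q).[e%:C] = p.[e%:C] * (q.[e%:C])^*.
  by rewrite hornerM -[in X in _ * X]conjc_real horner_map.
have : 0 <= Im (p * map_poly (@conjc R) q).[0].
  apply: limit_Im_ge0 => e e0; rewrite E hp hq.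
  apply: mixdet_ratio_open => // i; rewrite ImD ImM /=.
  by have := z0 i; lra.
rewrite -[0 in X in Im X]/(0%:C) E hp hq.
have zE : (fun i => z i + 'i * 0%:C) =1 z by move=> i; rewrite mulr0 addr0.
by rewrite !(eq_mixdet _ _ _ zE).
Qed.

Definition embR x : 'I_N -> C := fun i => (x i)%:C.

Definition rdet U S x : R := Re (mixdet A U S (embR x)).

Lemma mixdet_real U S x : mixdet A U S (embR x) = (rdet U S x)%:C.
Proof.
apply: real_of_conj; rewrite -[LHS]/(conjc _) map_mixdet.
have -> : map_mx conjc A = A^T by apply/matrixP => i j; rewrite !mxE;
  apply/esym/hA.
rewrite (@eq_mixdet _ _ _ _ _ _ (embR x)); last by move=> i; apply: conjc_real.
elim: U S => [|[a b] U IH] S /=; last by rewrite !IH.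
rewrite -det_tr; congr (\det _); apply/matrixP => i j;
  rewrite !mxE andbC (eq_sym j).
by case: eqP => // ->.
Qed.

Lemma embR_upd x c t : embR (upd x c t) =1 upd (embR x) c t%:C.
Proof. by move=> i; rewrite /embR /upd; case: ifP. Qed.

Lemma rdet_cons a b U S x :
  rdet ((a, b) :: U) S x = rdet U (a |: S) x + rdet U (b |: S) x.
Proof. by rewrite /rdet /= ReD. Qed.

Lemma rdet_affine U S x c : c \in S -> c \notin vars U ->
  rdet U S x = x c * rdet U (S :\ c) x + rdet U S (upd x c 0).
Proof.
move=> cS cU; rewrite {1}/rdet (mixdet_affine _ _ cS) // ReD mixdet_real.
by rewrite /rdet -(eq_mixdet _ _ _ (embR_upd x c 0)) /= mul0r subr0.
Qed.

Lemma rdet_indep U S x c t : c \notin S -> c \notin vars U ->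
  rdet U S (upd x c t) = rdet U S x.
Proof. by move=> cS cU;
  rewrite /rdet (eq_mixdet _ _ _ (embR_upd x c t)) mixdet_indep. Qed.

Lemma eq_rdet U S x y : x =1 y -> rdet U S x = rdet U S y.
Proof. by move=> xy; rewrite /rdet (@eq_mixdet _ _ _ _ _ _ (embR y)) // => i;
  rewrite /embR xy. Qed.

Lemma rdet_upd U S x c t : c \in S -> c \notin vars U ->
  rdet U S (upd x c t) = rdet U S x + (t - x c) * rdet U (S :\ c) x.
Proof.
move=> cS cU; rewrite (rdet_affine _ cS cU) [in RHS](rdet_affine _ cS cU).
rewrite updd rdet_indep ?inE ?eqxx // (eq_rdet _ _ (upd_upd _ _ _ _)).
ring.
Qed.

Lemma rdet_affine_any U S x d : exists al be, forall t,
  rdet U S (upd x d t) = al + be * t /\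
  mixdet A U S (upd (embR x) d 'i) = al +i* be.
Proof.
exists (rdet U S (upd x d 0)),
  (rdet U S (upd x d 1) - rdet U S (upd x d 0)) => t.
have E (s : R) : mixdet A U S (upd (embR x) d s%:C) = (rdet U S (upd x d s))%:C.
  by rewrite -mixdet_real -(eq_mixdet _ _ _ (embR_upd x d s)).
have E0 : mixdet A U S (upd (embR x) d 0) = (rdet U S (upd x d 0))%:C := E 0.
have E1 : mixdet A U S (upd (embR x) d 1) = (rdet U S (upd x d 1))%:C := E 1.
have H s := mixdet_affine_any A U S (embR x) d s; split.
  by have := H t%:C; rewrite E E0 E1 => /(congr1 Re) /=; lra.
by rewrite H E0 E1; apply: eqC => /=; ring.
Qed.

(** Multiplicative form of: [g / f] does not increase along any coordinate.  It
    makes sense, and for [rdet] it holds, whatever the signs of [f] and [g];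
    this is what allows the starting point of a monotonicity argument to be
    chosen freely. *)
Definition rayleigh_pair (f g : ('I_N -> R) -> R) := forall x d t, x d <= t ->
  f x * g (upd x d t) <= f (upd x d t) * g x.

(** In the variable [d], write the two functions as [al + be t] and
    [ga + et t]. Evaluating [mixdet_ratio_closed] at real values of the other
    variables and at ['i] for [d] yields [0 <= be * ga - al * et], which is the
    monotonicity of the quotient of two affine functions. *)
Lemma rayleigh_pair_rdet U S c :
  fresh U S -> c \in S -> rayleigh_pair (rdet U S) (rdet U (S :\ c)).
Proof.
move=> fU cS x d t xt; have cU := fresh_notin fU cS.
move: xt; case: (eqVneq d c) => [->|dc] xt.
  rewrite rdet_indep ?inE ?eqxx // rdet_upd // mulrDl lerDl -mulrA -expr2.
  by rewrite mulr_ge0 ?subr_ge0 ?sqr_ge0.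
have [al [be H]] := rdet_affine_any U S x d.
have [ga [et K]] := rdet_affine_any U (S :\ c) x d.
rewrite -(eq_rdet U S (upd_id x d)) -(eq_rdet U (S :\ c) (upd_id x d)).
rewrite !(H _).1 !(K _).1.
have : 0 <= be * ga - al * et.
  have := @mixdet_ratio_closed U S (upd (embR x) d 'i) c fU cS.
  rewrite (H 0).2 (K 0).2 /= => /(_ _)/le_trans; apply;
    last by rewrite le_eqVlt; apply/orP; left; apply/eqP; ring.
  by move=> i; rewrite /upd; case: ifP.
by nra.
Qed.

End Points.
End RealPoints.

(** * Positivity above a point, and interlacing *)

Section Orthant.
Variable R : rcfType.
Local Open Scope complex_scope.
Local Notation C := R[i].
Local Notation Re := (@complex.Re R).
Local Notation Im := (@complex.Im R).
Variable N : nat.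
Implicit Types (x y z : 'I_N -> R) (f g : ('I_N -> R) -> R).

Definition lep x y := forall i, x i <= y i.

Definition pos_above f z := forall y, lep z y -> 0 < f y.

Lemma rayleigh_pairD f1 f2 g :
  rayleigh_pair f1 g -> rayleigh_pair f2 g ->
  rayleigh_pair (fun x => f1 x + f2 x) g.
Proof. by move=> h1 h2 x d t xt; rewrite !mulrDl lerD ?h1 ?h2. Qed.

(** The coordinates are moved one after the other along [enum 'I_N]. *)
Lemma monotone_coordinatewise (r : ('I_N -> R) -> R) z :
  (forall x x', x =1 x' -> r x = r x') ->
  (forall x d t, lep z x -> x d <= t -> r x <= r (upd x d t)) ->
  forall x y, lep z x -> lep x y -> r x <= r y.
Proof.
move=> ext step x y zx xy.
pose mix (s : seq 'I_N) : 'I_N -> R := fun i => if i \in s then y i else x i.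
have H s : r x <= r (mix s).
  elim: s => [|d s IH]; first by rewrite (ext (mix [::]) x).
  apply: le_trans IH _; rewrite (ext (mix (d :: s)) (upd (mix s) d (y d)));
    last first.
    by move=> i; rewrite /mix /upd inE; case: eqP => // ->.
  apply: step => [i|]; rewrite /mix; case: ifP => // _.
  exact: le_trans (zx i) (xy i).
by apply: le_trans (H (enum 'I_N)) _; rewrite (ext _ y) // => i;
  rewrite /mix mem_enum.
Qed.

Definition extensional f := forall x x', x =1 x' -> f x = f x'.

Lemma rayleigh_ratio_nonincreasing f g z x y :
  extensional f -> extensional g -> rayleigh_pair f g ->
  pos_above f z -> lep z x -> lep x y -> g y * f x <= g x * f y.
Proof.
move=> ef eg fg fz zx xy.
have fx := fz _ zx; have fy : 0 < f y by apply: fz => i;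
  apply: le_trans (zx i) (xy i).
rewrite -ler_pdivlMr // mulrAC -ler_pdivrMr // -lerN2.
apply: (@monotone_coordinatewise (fun u => - (g u / f u)) z) => // [u v uv|u
  d t zu ut].
  by rewrite (ef u v) ?(eg u v).
have zu' : lep z (upd u d t).
  by move=> i; rewrite /upd; case: eqP => [->|_] //; apply: le_trans (zu d) ut.
rewrite lerN2 ler_pdivrMr ?fz // mulrAC ler_pdivlMr ?fz // mulrC [leRHS]mulrC.
exact: fg.
Qed.

Lemma rayleigh_ratio_nondecreasing f g z x y :
  extensional f -> extensional g -> rayleigh_pair f g ->
  pos_above g z -> lep z x -> lep x y -> f x / g x <= f y / g y.
Proof.
move=> ef eg fg gz;
  apply: (@monotone_coordinatewise (fun u => f u / g u) z) => [u v uv|u d t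
  zu ut].
  by rewrite (ef u v) ?(eg u v).
have zu' : lep z (upd u d t).
  by move=> i; rewrite /upd; case: eqP => [->|_] //; apply: le_trans (zu d) ut.
by rewrite ler_pdivrMr ?gz // mulrAC ler_pdivlMr ?gz //; apply: fg.
Qed.

(** Any value above 1 would do in place of 2: beyond 1 everything is positive,
    by [rdet_big]. *)
Definition raised z : 'I_N -> R := fun i => Num.max (z i) 2.

Lemma lep_raised z : lep z (raised z). Proof.
  by move=> i; rewrite le_max lexx. Qed.

Lemma lep_refl z : lep z z. Proof. by move=> i. Qed.

Lemma lep_trans z x y : lep z x -> lep x y -> lep z y.
Proof. by move=> a b i; apply: le_trans (a i) (b i). Qed.

(** Positivity of [g] far away is transported back along the monotone quotient
    [g / f]; it is applied to a derivative [g] of [f]. *)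
Lemma rayleigh_pos_above f g z :
  extensional f -> extensional g -> rayleigh_pair f g ->
  (forall y, (forall i, 1 < y i) -> 0 < g y) -> pos_above f z -> pos_above g z.
Proof.
move=> ef eg fg gbig fz y zy.
have yu := lep_raised y; have := rayleigh_ratio_nonincreasing ef eg fg fz zy yu.
have gu : 0 < g (raised y).
  by apply: gbig => i; rewrite /raised lt_max (_ : (1 : R) < 2) ?orbT // ltr1n.
have fy := fz _ zy; have fu := fz _ (lep_trans zy yu).
by move/(lt_le_trans (mulr_gt0 gu fy)); rewrite pmulr_lgt0.
Qed.

Section Det.
Variables (A : 'M[C]_N).
Hypothesis hA : herm A.
Hypothesis A1 : forall v, qf A v <= nsq v.
Implicit Types (S : {set 'I_N}) (U : seq ('I_N * 'I_N)).

Lemma rdet_ext U S : extensional (rdet A U S).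
Proof. by move=> x y; apply: eq_rdet. Qed.

(** Beyond 1 the matrix [diag y - A] is positive definite.  Instead of
    diagonalizing it: the determinant is affine in each variable with positive
    slope, by induction on [S], and cannot vanish, so it is positive. *)
Lemma rdet_big U S y : (forall i, 1 < y i) -> 0 < rdet A U S y.
Proof.
elim: U S y => [|[a b] U IH] S y y1; last by rewrite rdet_cons addr_gt0 ?IH.
have nz T x : (forall i, 1 < x i) -> rdet A [::] T x != 0.
  move=> x1; apply/eqP => e0.
  have : \det (pencil A T (embR x)) =
    0 by rewrite -[LHS]/(mixdet A [::] T _) mixdet_real // e0.
  case/pencil_kernel => // v [v0 _ /(congr1 Re) /=]; rewrite Re_sum => E.
  pose w i := Re (v i 0) ^+ 2 + Im (v i 0) ^+ 2.
  have w0 i : 0 <= w i by rewrite addr_ge0 ?sqr_ge0.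
  have p i : 0 <= (x i - 1) * w i by rewrite mulr_ge0 // subr_ge0 ltW.
  have h : \sum_i (x i - 1) * w i <= 0.
    have := A1 v; rewrite -E -subr_le0 /nsq -sumrB; congr (_ <= _).
    by apply: eq_bigr => i _; rewrite !(ReM, ImM, ReJ, ImJ) /w /=; ring.
  case/negP: v0; apply/eqP; apply: nsq_eq0; apply: big1 => i _.
  have : \sum_i (x i - 1) * w i == 0 by rewrite eq_le h sumr_ge0.
  rewrite psumr_eq0 // => /allP/(_ i (mem_index_enum _)) /=.
  by rewrite mulf_eq0 subr_eq0 gt_eqF //= => /eqP.
have [n] := ubnP #|S|; elim: n S y y1 => // n IHn S y y1 Sn.
have [->|[c cS]] := set_0Vmem S.
  rewrite /rdet /= (_ : pencil _ _ _ = 1%:M) ?det1 ?ltr01 //.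
  by apply/matrixP => i j; rewrite !mxE inE.
have p : 0 < rdet A [::] (S :\ c) y.
  by apply: IHn => //; move: Sn; rewrite (cardsD1 c) cS.
rewrite ltNge; apply/negP => neg.
pose t := y c - rdet A [::] S y / rdet A [::] (S :\ c) y.
have yt : y c <= t by rewrite lerDl oppr_ge0 mulr_le0_ge0 ?invr_ge0 // ltW.
have /negP[] : rdet A [::] S (upd y c t) != 0.
  by apply: nz => i; rewrite /upd; case: eqP => // _;
    apply: lt_le_trans (y1 c) yt.
by rewrite rdet_upd // /t addrAC subrr add0r mulNr divfK ?subrr // gt_eqF.
Qed.

Lemma rdet_deriv_pos U S c z : fresh U S -> c \in S ->
  pos_above (rdet A U S) z -> pos_above (rdet A U (S :\ c)) z.
Proof.
move=> fU cS; apply: rayleigh_pos_above; try exact: rdet_ext;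
  first exact: rayleigh_pair_rdet.
by move=> y; apply: rdet_big.
Qed.

(** Above [z] the sum of the two halves is positive, hence so is their common
    derivative [h], and each half divided by [h] increases in every variable.
    So it is enough that a half be positive at the corner [z] itself, and one of
    the two is, since their sum is. *)
Lemma interlacing a b U S z : fresh ((a, b) :: U) S ->
  pos_above (rdet A ((a, b) :: U) S) z ->
  pos_above (rdet A U (a |: S)) z \/ pos_above (rdet A U (b |: S)) z.
Proof.
rewrite fresh_cons => /and5P[ab aS bS aU /andP[bU fU]] pz.
have ra : rayleigh_pair (rdet A U (a |: S)) (rdet A U S).
  by rewrite -[in X in rayleigh_pair _ X](setU1K aS);
    apply: rayleigh_pair_rdet; rewrite ?setU11 //; apply: fresh_setU1.
have rb : rayleigh_pair (rdet A U (b |: S)) (rdet A U S).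
  by rewrite -[in X in rayleigh_pair _ X](setU1K bS);
    apply: rayleigh_pair_rdet; rewrite ?setU11 //; apply: fresh_setU1.
have hz : pos_above (rdet A U S) z.
  apply: (rayleigh_pos_above (f := fun x => rdet A U (a |: S) x + rdet A U (b
    |: S) x)).
  - by move=> x y xy; rewrite !(eq_rdet _ _ _ xy).
  - exact: rdet_ext.
  - exact: rayleigh_pairD.
  - by move=> y; apply: rdet_big.
  - by move=> y /pz; rewrite rdet_cons.
have hz0 := hz _ (lep_refl z).
have := pz _ (lep_refl z); rewrite rdet_cons => sum0.
have [pa|na] := ltP 0 (rdet A U (a |: S) z); [left|right] => y zy.
  have := rayleigh_ratio_nondecreasing (rdet_ext _ _) (rdet_ext _ _) ra hz
    (lep_refl z) zy.
  by move/(lt_le_trans (divr_gt0 pa hz0)); rewrite pmulr_lgt0 // invr_gt0 hz.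
have pb : 0 < rdet A U (b |: S) z by lra.
have := rayleigh_ratio_nondecreasing (rdet_ext _ _) (rdet_ext _ _) rb hz
  (lep_refl z) zy.
by move/(lt_le_trans (divr_gt0 pb hz0)); rewrite pmulr_lgt0 // invr_gt0 hz.
Qed.

End Det.
End Orthant.

(** * The barrier argument *)

Section Barrier.
Variable R : rcfType.
Local Open Scope complex_scope.
Local Notation C := R[i].
Variables (N : nat) (A : 'M[C]_N).
Hypothesis hA : herm A.
Hypothesis A1 : forall v, qf A v <= nsq v.
Implicit Types (S : {set 'I_N}) (U : seq ('I_N * 'I_N)) (x y z : 'I_N -> R).

(** The algebra behind [barrier_dec].  The letters are the partial derivatives
    at one point of a function of three variables a, b, c; the last two
    hypotheses are Rayleigh's inequalities for (a, c) at that point and for (b,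
    c) after lowering the variable a by [e].  The conclusion compares
    logarithmic derivatives in c before and after applying the sum of the
    derivations in a and b and lowering a and b by [e / 2] each.  After
    multiplication by the positive [p0 - e * pa], the difference of the two
    sides is a sum of two products of nonnegative factors. *)
Lemma barrier_ineq (p0 pa pb pc pab pac pbc pabc e : R) :
  0 < p0 -> 0 < pb -> 0 <= pab -> 0 < e -> e * (pa + pb) <= p0 ->
  p0 * pac <= pa * pc ->
  (p0 - e * pa) * (pbc - e * pabc) <= (pb - e * pab) * (pc - e * pac) ->
  (pbc + pac - e * pabc) * p0 <= (pa + pb - e * pab) * pc.
Proof.
move=> p00 pb0 pab0 e0 le q D.
have k0 : 0 < p0 - e * pa by have := mulr_gt0 e0 pb0; lra.
rewrite -subr_ge0 -(pmulr_rge0 _ k0).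
have -> : (p0 - e * pa) * ((pa + pb - e * pab) * pc - (pbc + pac - e * pabc)
  * p0) =
  p0 * ((pb - e * pab) * (pc - e * pac) - (p0 - e * pa) * (pbc - e * pabc)) +
  (pa * pc - p0 * pac) * (p0 - e * (pa + pb) + e ^+ 2 * pab) by ring.
apply: addr_ge0; apply: mulr_ge0; rewrite ?subr_ge0 //; first exact: ltW.
by rewrite addr_ge0 ?subr_ge0 // mulr_ge0 // sqr_ge0.
Qed.

(** The infinitesimal form of [rayleigh_pair_rdet], from a unit step. *)
Lemma rayleigh U S c d x : fresh U S -> c \in S -> d \in S -> c != d ->
  rdet A U S x * rdet A U (S :\ c :\ d) x <=
    rdet A U (S :\ d) x * rdet A U (S :\ c) x.
Proof.
move=> fU cS dS cd; have dU := fresh_notin fU dS.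
have := @rayleigh_pair_rdet _ _ _ hA U S c fU cS x d (x d + 1).
have dSc : d \in S :\ c by rewrite !inE eq_sym cd.
by rewrite !rdet_upd // => /(_ ltac:(by rewrite lerDl ler01)); lra.
Qed.

Definition lower2 a b (de : R) y : 'I_N -> R :=
  fun i => if (i == a) || (i == b) then y i - de else y i.

(** Choosing [a] differentiates in the variable of [b], and conversely; each
    term of the sum depends on one of the two lowered variables. *)
Lemma rdet_lower2 a b U S de y : fresh ((a, b) :: U) S ->
  rdet A ((a, b) :: U) S (lower2 a b de y) =
    rdet A U (a |: S) y + rdet A U (b |: S) y - 2 * de * rdet A U S y.
Proof.
rewrite fresh_cons => /and5P[ab aS bS aU /andP[bU fU]]; rewrite rdet_cons.
have ba : b != a by rewrite eq_sym.
have E1 : lower2 a b de y =1 upd (upd y a (y a - de)) b (y b - de).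
  by move=> i; rewrite /lower2 /upd; case: eqP => [->|];
    rewrite ?(negbTE ab) //=; case: eqP => [->|].
have E2 : lower2 a b de y =1 upd (upd y b (y b - de)) a (y a - de).
  by move=> i; rewrite E1 updC.
rewrite (eq_rdet _ _ _ E1) rdet_indep ?inE ?negb_or ?ba //.
rewrite [in X in _ + X](eq_rdet _ _ _ E2) [in X in _ + X]rdet_indep ?inE
  ?negb_or ?ab //.
rewrite !rdet_upd ?setU11 // !setU1K //; ring.
Qed.

Section Step.
Variables (a b : 'I_N) (U : seq ('I_N * 'I_N)) (S : {set 'I_N}) (z :
  'I_N -> R) (phi : R).
Let T := a |: (b |: S).
Hypothesis fr : fresh ((a, b) :: U) S.
Hypothesis Tz : pos_above (rdet A U T) z.
Hypothesis phi0 : 0 < phi.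
Hypothesis le_phi :
  rdet A U (b |: S) z + rdet A U (a |: S) z <= phi * rdet A U T z.

Let ab : a != b. Proof. by move: fr; rewrite fresh_cons => /and5P[]. Qed.
Let aS : a \notin S. Proof. by move: fr; rewrite fresh_cons => /and5P[]. Qed.
Let bS : b \notin S. Proof. by move: fr; rewrite fresh_cons => /and5P[]. Qed.
Let aU : a \notin vars U. Proof.
  by move: fr; rewrite fresh_cons => /and5P[]. Qed.
Let bU : b \notin vars U. Proof.
  by move: fr; rewrite fresh_cons => /and5P[_ _ _ _ /andP[]]. Qed.
Let fU : fresh U S. Proof.
  by move: fr; rewrite fresh_cons => /and5P[_ _ _ _ /andP[]]. Qed.
Let fT : fresh U T. Proof. by rewrite !fresh_setU1. Qed.
Let aT : a \in T. Proof. by rewrite setU11. Qed.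
Let bT : b \in T. Proof. by rewrite !inE eqxx orbT. Qed.
Let Ta : T :\ a = b |: S. Proof. by rewrite setU1K // !inE negb_or ab. Qed.
Let Tb : T :\ b = a |: S. Proof.
  by rewrite /T finset.setUCA setU1K // !inE negb_or eq_sym ab. Qed.
Let Tab : T :\ a :\ b = S. Proof. by rewrite Ta setU1K. Qed.

Lemma derivs_pos y : lep z y ->
  [/\ 0 < rdet A U T y, 0 < rdet A U (b |: S) y, 0 < rdet A U (a |: S) y,
      0 < rdet A U S y &
      rdet A U (b |: S) y + rdet A U (a |: S) y <= phi * rdet A U T y].
Proof.
move=> zy.
have Pa : pos_above (rdet A U (b |: S)) z by rewrite -Ta; apply: rdet_deriv_pos.
have Pb : pos_above (rdet A U (a |: S)) z by rewrite -Tb; apply: rdet_deriv_pos.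
have Pab : pos_above (rdet A U S) z.
  rewrite -(setU1K bS); apply: rdet_deriv_pos; rewrite ?setU11 //;
    exact: fresh_setU1.
split; [exact: Tz | exact: Pa | exact: Pb | exact: Pab |].
have dec c : c \in T ->
  rdet A U (T :\ c) y * rdet A U T z <= rdet A U (T :\ c) z * rdet A U T y.
  move=> cT; apply: (@rayleigh_ratio_nonincreasing _ _ _ _ z) => //;
    try exact: rdet_ext.
  exact: rayleigh_pair_rdet.
have := dec a aT; have := dec b bT; rewrite Ta Tb => h1 h2.
have Tz0 := Tz (lep_refl z); have Ty0 := Tz zy.
rewrite -(ler_pM2r Tz0);
  apply: le_trans (_ : (phi * rdet A U T z) * rdet A U T y <= _).
  by apply: le_trans (ler_wpM2r (ltW Ty0) le_phi); rewrite !mulrDl lerD.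
by rewrite -!mulrA [rdet _ _ _ z * _]mulrC.
Qed.

(** At a point [y'] above [z] put [p0 = rdet A U T y'] and let [pa], [pb],
    [pab] be its derivatives.  The value to be bounded is
    [pa + pb - pab / phi], where [p0 * pab <= pa * pb] by Rayleigh and
    [pa + pb <= phi * p0] because logarithmic derivatives decrease. *)
Lemma barrier_pos : pos_above (rdet A ((a,
  b) :: U) S) (lower2 a b (phi^-1 / 2) z).
Proof.
move=> y zy; pose y' := lower2 a b (- (phi^-1 / 2)) y.
have zy' : lep z y'.
  by move=> i; have := zy i; rewrite /y' /lower2; case: ifP => // _; lra.
have -> : rdet A ((a, b) :: U) S y = rdet A ((a,
  b) :: U) S (lower2 a b (phi^-1 / 2) y').
  by apply: eq_rdet => i; rewrite /y' /lower2; case: (_ || _) => //;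
    rewrite opprK addrK.
rewrite rdet_lower2 //.
have [p0 pa pb pab le] := derivs_pos zy'.
have := @rayleigh U T a b y' fT aT bT ab; rewrite Tab Ta Tb.
move: p0 pa pb pab le; set p0 := rdet A U T y'; set pa := rdet A U (b |: S) y'.
set pb := rdet A U (a |: S) y';
  set pab := rdet A U S y' => p00 pa0 pb0 pab0 le r.
rewrite -(pmulr_rgt0 _ (mulr_gt0 phi0 p00)).
have -> : phi * p0 * (pb + pa - 2 * (phi^-1 / 2) * pab) =
  phi * p0 * (pa + pb) - p0 * pab.
  by field; rewrite gt_eqF.
have h : (pa + pb) * (pa + pb) <=
  phi * p0 * (pa + pb) by rewrite ler_wpM2r // addr_ge0 ?ltW.
have := mulr_gt0 pa0 pa0; have := mulr_gt0 pb0 pb0; have := mulr_gt0 pa0 pb0.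
by nra.
Qed.

(** Logarithmic derivatives in the remaining variables do not increase: by
    [barrier_ineq], fed with Rayleigh's inequality for [a] and [c] at [z] and
    for [b] and [c] at the point where the variable of [a] is lowered by
    [phi^-1], that is by twice the final shift. *)
Lemma barrier_dec c : c \in S ->
  rdet A ((a, b) :: U) (S :\ c) (lower2 a b (phi^-1 / 2) z) * rdet A U T z <=
  rdet A ((a, b) :: U) S (lower2 a b (phi^-1 / 2) z) * rdet A U (T :\ c) z.
Proof.
move=> cS; have frc : fresh ((a,
  b) :: U) (S :\ c) by apply: fresh_sub (subsetDl _ _) fr.
have ac : a != c by apply: contraNneq aS => ->.
have bc : b != c by apply: contraNneq bS => ->.
have cT : c \in T by rewrite !inE cS !orbT.
have cU := fresh_notin fU cS.
rewrite !rdet_lower2 // (_ : 2 * (phi^-1 / 2) = phi^-1); last by field;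
  rewrite gt_eqF.
have [p0 pa pb pab le] := derivs_pos (lep_refl z).
have Tac : T :\ a :\ c = b |: (S :\ c) by rewrite Ta setU1D1.
have Tbc : T :\ b :\ c = a |: (S :\ c) by rewrite Tb setU1D1.
have := @rayleigh U T a c z fT aT cT ac; rewrite Ta setU1D1 // => q.
have := @rayleigh U T b c (upd z a (z a - phi^-1)) fT bT cT bc.
rewrite !rdet_upd ?inE ?eqxx ?ab ?ac ?orbT ?aT //.
have -> : T :\ b :\ c :\ a = S :\ c.
  by rewrite Tbc setU1K // !inE negb_and (negbTE aS) orbT.
have -> : T :\ b :\ a = S by rewrite Tb setU1K.
have -> : T :\ c :\ a = b |: (S :\ c).
  by rewrite -Tac !finset.setDDl finset.setUC.
rewrite Ta Tb setU1D1 // => D.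
rewrite [X in (X - _) * rdet A U T z <= _]addrC [X in _ <= (X - _) * _]addrC.
rewrite [X in (X - _) * rdet A U T z <= _]addrC.
apply: barrier_ineq => //; first exact: ltW; first by rewrite invr_gt0.
- by rewrite mulrC ler_pdivrMr // mulrC.
- by rewrite [leRHS]mulrC.
move: D; rewrite (_ : z a - phi^-1 - z a = - phi^-1); last by ring.
by rewrite !mulNr [X in _ <= X]mulrC.
Qed.

End Step.

Definition lowered (x0 de : R) U :
  'I_N -> R := fun i => if i \in vars U then x0 - de else x0.

(** All pairs have been processed when [S] is empty.  The bound [phi / 2] on
    each logarithmic derivative is the invariant: a pair then contributes
    [phi], which is what one step requires. *)
Lemma barrier U S (x0 phi : R) : 1 < x0 -> 0 < phi -> fresh U S ->
  let T := S :|: [set i in vars U] in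
  (forall c, c \in T ->
    rdet A [::] (T :\ c) (fun=> x0) <= phi / 2 * rdet A [::] T (fun=> x0)) ->
  pos_above (rdet A U S) (lowered x0 (phi^-1 / 2) U) /\
  forall c, c \in S -> rdet A U (S :\ c) (lowered x0 (phi^-1 / 2) U) <=
                 phi / 2 * rdet A U S (lowered x0 (phi^-1 / 2) U).
Proof.
move=> x01 phi0; elim: U S => [|[a b] U IH] S fr T hT.
  have TS : T = S by apply/setP => i; rewrite !inE orbF.
  split; last by move=> c cS; move: (hT c); rewrite TS; apply.
  by move=> y hy; apply: rdet_big => // i; apply: lt_le_trans x01 (hy i).
have := fr; rewrite fresh_cons => /and5P[ab aS bS aU /andP[bU fU]].
have TE : T = (a |: (b |: S)) :|: [set i in vars U].
  by apply/setP => i;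
    rewrite !(finset.in_setU, finset.in_set1, finset.in_set) mem_vars /=;
    do !case: (_ == _); rewrite ?orbT.
have [||pos dec] := IH (a |: (b |: S)); first by rewrite !fresh_setU1.
  by move=> c; rewrite -TE; apply: hT.
set z := lowered x0 _ U in pos dec.
have zE : lowered x0 (phi^-1 / 2) ((a, b) :: U) =1 lower2 a b (phi^-1 / 2) z.
  move=> i; rewrite /lowered /lower2 /z /lowered mem_vars /=.
  by case: eqP => [->|_] /=; [|case: eqP => [->|_] //=];
    rewrite ?(negbTE aU) ?(negbTE bU).
have aT : a \in a |: (b |: S) by rewrite setU11.
have bT : b \in a |: (b |: S) by rewrite !inE eqxx orbT.
have le : rdet A U (b |: S) z + rdet A U (a |: S) z <=
  phi * rdet A U (a |: (b |: S)) z.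
  have := dec a aT; have := dec b bT.
  rewrite setU1K ?inE ?negb_or ?ab // finset.setUCA setU1K ?inE ?negb_or
    1?eq_sym ?ab //.
  by lra.
have pz := barrier_pos fr pos phi0 le.
split=> [y hy|c cS]; first by apply: pz => i; rewrite -zE.
rewrite !(eq_rdet _ _ _ zE).
have cT : c \in a |: (b |: S) by rewrite !inE cS !orbT.
have T0 := pos _ (lep_refl z).
rewrite -(ler_pM2r T0); apply: le_trans (barrier_dec fr pos phi0 le cS) _.
rewrite [leRHS]mulrAC [leRHS]mulrC ler_pM2l; first exact: dec.
exact/pz/lep_refl.
Qed.
End Barrier.

(** * From determinants back to quadratic forms *)

Section Spectral.
Variable R : rcfType.
Local Open Scope complex_scope.
Local Open Scope sesquilinear_scope.
Local Notation C := R[i].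
Local Notation Re := (@complex.Re R).
Local Notation Im := (@complex.Im R).

Definition sqn (x : C) : R := Re x ^+ 2 + Im x ^+ 2.

Lemma sqn_ge0 x : 0 <= sqn x. Proof. by rewrite addr_ge0 ?sqr_ge0. Qed.

Lemma sqnE (x : C) : x^* * x = (sqn x)%:C.
Proof. by apply: eqC; rewrite /sqn !(ReM, ImM, ReJ, ImJ) /=; ring. Qed.

Lemma hdotE n (u v : 'cV[C]_n) : hdot u v = ((u^t* ) *m v) 0 0.
Proof. by rewrite mxE; apply: eq_bigr => i _; rewrite !mxE. Qed.

Lemma hdotZr n (a : C) (u v : 'cV[C]_n) : hdot u (a *: v) = a * hdot u v.
Proof. by rewrite /hdot mulr_sumr; apply: eq_bigr => i _;
  rewrite mxE mulrCA. Qed.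

Lemma hdotDr n (u v w : 'cV[C]_n) : hdot u (v + w) = hdot u v + hdot u w.
Proof. by rewrite /hdot -big_split; apply: eq_bigr => i _;
  rewrite mxE mulrDr. Qed.

Lemma hdotNr n (u v : 'cV[C]_n) : hdot u (- v) = - hdot u v.
Proof. by rewrite -scaleN1r hdotZr mulN1r. Qed.

Lemma herm_spectral n (B : 'M[C]_n) : herm B ->
  exists P (l : 'I_n -> R),
  [/\ forall v, nsq (P *m v) = nsq v,
      forall v, qf B v = \sum_i l i * sqn ((P *m v) i 0),
      forall i, row i P *m B = (l i)%:C *: row i P &
      forall i, row i P != 0].
Proof.
move=> hB; have Bh : B \is hermsymmx.
  apply/is_hermitianmxP; rewrite expr0 scale1r; apply/matrixP => i j.
  by rewrite !mxE -[RHS]hB.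
have sreal := hermitian_spectral_diag_real Bh.
have /hermitian_normalmx/orthomx_spectralP := Bh.
have := spectral_unitarymx B; set P := spectralmx B;
  set sp := spectral_diag B => Pu.
rewrite (invmx_unitary Pu) => EB.
have PP : P *m P^t* = 1%:M by apply/unitarymxP.
have PP' : P^t* *m P = 1%:M by apply: mulmx1C.
pose l i := Re (sp 0 i); exists P, l.
have spE i : sp 0 i = (l i)%:C by rewrite RRe_real //; apply/mxOverP.
have adj u v : hdot u (P^t* *m v) = hdot (P *m u) v.
  by rewrite !hdotE trmx_mul map_mxM mulmxA.
split.
- move=> v; apply: (@complexI R); rewrite -!hdot_self -adj mulmxA PP' mul1mx //.
- move=> v; rewrite /qf {1}EB -!mulmxA adj /hdot Re_sum; apply: eq_bigr => i _.
  rewrite mul_diag_mx [X in _ * X]mxE spE mulrCA sqnE.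
  by rewrite ReM /= mul0r subr0.
- move=> i; rewrite -row_mul EB !mulmxA PP mul1mx row_mul row_diag_mx
  -scalemxAl -rowE spE.
  by [].
- move=> i; apply/eqP => r0; have := congr1 (row i) PP.
  rewrite row_mul r0 mul0mx => /matrixP/(_ 0 i); rewrite !mxE eqxx => /esym/eqP.
  by rewrite oner_eq0.
Qed.

(** An eigenvalue [l > rho] of the compression of [A] to [S] is nonzero, so its
    eigenvectors live on [S] and lie in the kernel of the pencil at [l]. *)
Lemma pos_above_form n (A : 'M[C]_n) (S : {set 'I_n}) (rho : R) :
  herm A -> 0 < rho ->
  pos_above (rdet A [::] S) (fun=> rho) ->
  forall v : 'cV_n, (forall i,
    i \notin S -> v i 0 = 0) -> qf A v <= rho * nsq v.
Proof.
move=> hA rho0 pos v vS.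
pose B : 'M[C]_n := \matrix_(i, j) if (i \in S) && (j \in S) then A i j else 0.
have hB : herm B.
  by move=> i j; rewrite !mxE andbC; case: ifP => _; rewrite ?rmorph0 //;
    apply: hA.
have [P [l [Pn qB Pl Pr]]] := herm_spectral hB.
have lrho i : l i <= rho.
  rewrite leNgt; apply/negP => li; have l0 := lt_trans rho0 li.
  have : 0 < rdet A [::] S (fun=> l i) by apply: pos => j; apply: ltW.
  suff /eqP d0 :
    \det (pencil A S (embR (fun=> l i))) == 0 by rewrite /rdet /= d0 ltxx.
  apply/det0P; exists (row i P) => //; apply/matrixP => k j;
    rewrite ord1 [RHS]mxE mxE.
  have /matrixP/(_ 0 j) := Pl i; rewrite [LHS]mxE [RHS]mxE.
  set p := row i P => pj.
  have [jS|jS] := boolP (j \in S); last first.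
    have p0 : p 0 j = 0.
      move: pj; rewrite big1 => [|k' _];
        last by rewrite [B _ _]mxE (negbTE jS) andbF mulr0.
      move=> /esym/eqP; rewrite mulf_eq0 => /orP[/eqP/complexI|/eqP //] e0.
      by rewrite e0 ltxx in l0.
    rewrite (bigD1 j) //= p0 mul0r add0r big1 // => k' kj.
    by rewrite [pencil _ _ _ _ _]mxE (negbTE jS) andbF (negbTE kj) mulr0.
  rewrite (eq_bigr (fun k' => p 0 k' * ((l i)%:C *+ (k' == j)) - p 0 k' * B
    k' j)).
    rewrite sumrB pj (bigD1 j) //= eqxx big1 ?addr0 => [|k' kj];
      first by rewrite mulr1n mulrC subrr.
    by rewrite (negbTE kj) mulr0n mulr0.
  move=> k' _; rewrite [pencil _ _ _ _ _]mxE [B _ _]mxE jS andbT -mulrBr;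
    case: ifP => // kS.
  by rewrite subr0; case: eqP kS => [->|]; rewrite ?jS.
have -> : qf A v = qf B v.
  rewrite /qf /hdot; congr (Re _); apply: eq_bigr => i _.
  have [iS|iS] := boolP (i \in S); last by rewrite vS // rmorph0 !mul0r.
  congr (_ * _); rewrite !mxE; apply: eq_bigr => j _; rewrite mxE iS /=.
  by case: ifP => // /negbT /vS ->; rewrite !mulr0.
rewrite qB -Pn /nsq mulr_sumr; apply: ler_sum => i _.
by rewrite ler_wpM2r ?sqn_ge0.
Qed.

Section Resolvent.
Variables (N : nat) (A : 'M[C]_N).
Hypothesis hA : herm A.
Hypothesis A1 : forall v, qf A v <= nsq v.
Hypothesis A0 : forall i, A i i = 0.

Lemma nsq_subZ n (y w : 'cV[C]_n) (l : R) :
  nsq (y - l%:C *: w) = nsq y - 2 * l * Re (hdot w y) + l ^+ 2 * nsq w.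
Proof.
rewrite /nsq /hdot Re_sum !mulr_sumr -sumrB -big_split /=;
  apply: eq_bigr => i _.
rewrite !mxE; case: (y i 0) => a b; case: (w i 0) => c d /=; ring.
Qed.

(** The quotient of the two determinants is the entry (c, c) of the resolvent
    [(x - A)^-1].  With zero diagonal, the resolvent identity writes it as
    [1 / x + <w, (x - A)^-1 w> / x^2], where [w] is the column [c] of [A], and
    [(x - A)^-1 <= 1 / (x - 1)].  Everything is multiplied by the determinant
    [d] and expressed with [y = A u], where [u] is a column of the adjugate. *)
Lemma resolvent_bound (x s : R) c : 1 < x -> nsq (col c A) <= s ->
  x * (x * rdet A [::] ([set: 'I_N] :\ c) (fun=> x)) <=
  (s / (x - 1) + x) * rdet A [::] [set: 'I_N] (fun=> x).
Proof.
move=> x1 ws; set z : 'I_N -> R := fun=> x.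
have := @rdet_big _ _ _ hA A1 [::] [set: 'I_N] z (fun=> x1).
set d := rdet _ _ _ _ => d0; set g := rdet _ _ _ _.
pose M := pencil A [set: 'I_N] (embR z).
have ME : M = (x%:C)%:M - A by apply/matrixP => i j; rewrite !mxE !inE /=.
have dE : \det M =
  d%:C by rewrite -[LHS]/(mixdet A [::] [set: 'I_N] _) mixdet_real.
pose e : 'cV[C]_N := delta_mx c 0; pose u := \adj M *m e.
have Mu : M *m u = d%:C *: e.
  by rewrite /u mulmxA mul_mx_adj dE mul_scalar_mx.
have uc : u c 0 = g%:C.
  rewrite /u -colE mxE mxE /g -(mixdet_real hA) /= -(cofactor_pencil A _
    (embR z c) (finset.in_setT c)).
  by congr cofactor; apply/matrixP => i j; rewrite !mxE upd_id.
have Me : M *m e = x%:C *: e - col c A by rewrite ME mulmxBl mul_scalar_mx colE.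
set w := col c A in ws Me.
pose y := x%:C *: u - d%:C *: e.
have My : M *m y = d%:C *: w.
  rewrite /y mulmxBr -!scalemxAr Mu Me scalerBr !scalerA mulrC opprB addrC
    subrK.
  by [].
have yc : y c 0 = (x * g - d)%:C.
  rewrite mxE [in X in _ + X]mxE [in X in _ - X]mxE mxE uc mxE eqxx mulr1.
  by rewrite rmorphB rmorphM.
have tau : hdot w y = (x * (x * g - d))%:C.
  have : (A *m y) c 0 = x%:C * y c 0 - d%:C * w c 0.
    have /(congr1 (fun B : 'cV_N => B c 0)) := My;
      rewrite ME mulmxBl mul_scalar_mx.
    rewrite [LHS]mxE [X in X + _]mxE [X in _ + X]mxE [RHS]mxE => <-.
    by rewrite opprB addrC subrK.
  rewrite yc [w c 0]mxE A0 mulr0 subr0 rmorphM /= => <-; rewrite mxE /hdot.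
  by apply: eq_bigr => i _; rewrite [w _ _]mxE (hA i c).
have h1 : (x - 1) * nsq y <= d * (x * (x * g - d)).
  have : Re (hdot y (M *m y)) = d * (x * (x * g - d)).
    by rewrite My hdotZr hdotC tau ReM ReJ /= mul0r subr0.
  rewrite ME mulmxBl mul_scalar_mx => <-.
  rewrite hdotDr hdotNr hdotZr.
  rewrite hdot_self qf_real // -rmorphM -rmorphB /=.
  by have := A1 y; lra.
have x10 : 0 < x - 1 by rewrite subr_gt0.
(* in view of [h1], this multiple of [w] gives the best bound on [t] below *)
have := nsq_ge0 (y - (d / (x - 1))%:C *: w); rewrite nsq_subZ tau /=.
move: h1 ws; set t := x * (x * g - d) => h1 ws h2.
have h3 : t <= d * (s / (x - 1)).
  have : 0 <= (x - 1) * (nsq y - 2 * (d / (x - 1)) * t + (d / (x - 1)) ^+ 2 *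
    nsq w).
    by rewrite pmulr_rge0.
  have -> : (x - 1) * (nsq y - 2 * (d / (x - 1)) * t + (d / (x - 1)) ^+ 2 *
    nsq w) =
    (x - 1) * nsq y - 2 * (d * t) + d * (d * (nsq w / (x - 1))) by field;
      rewrite gt_eqF.
  move=> h4; have : d * t <= d * (d * (nsq w / (x - 1))) by lra.
  rewrite ler_pM2l // => /le_trans; apply; rewrite ler_pM2l //.
  by rewrite ler_pM2r // invr_gt0.
by rewrite /t in h3; lra.
Qed.

End Resolvent.
End Spectral.

(** * Two colours for a Hermitian matrix with short rows *)

Section Colouring.
Variable R : rcfType.
Local Open Scope complex_scope.
Local Notation C := R[i].
Local Notation Re := (@complex.Re R).
Local Notation Im := (@complex.Im R).

(** Minimize the weight inside the classes.  Recolouring [k] changes it by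
    twice the difference of the weights that [k] sends to the two colours, so
    at a minimum the weight sent to its own colour is at most that sent to any
    other, hence at most the average. *)
Lemma unfriendly_colouring n q (w : 'I_n -> 'I_n -> R) :
  (forall i j, w i j = w j i) -> (forall i, w i i = 0) ->
  exists c : 'I_n -> 'I_q.+1, forall k,
    q.+1%:R * (\sum_(j | c j == c k) w k j) <= \sum_j w k j.
Proof.
move=> wC w0.
pose E (c : {ffun 'I_n ->
  'I_q.+1}) := \sum_i \sum_j (if c i == c j then w i j else 0).
have [c _ cmin] := @arg_minP _ _ _ [ffun=> ord0] xpredT E isT.
exists c => k.
pose rest (c' : {ffun 'I_n -> 'I_q.+1}) :=
  \sum_(i | i != k) \sum_(j | j != k) (if c' i == c' j then w i j else 0).
have ED c' : E c' =
  2 * (\sum_(j | j != k) if c' j == c' k then w k j else 0) + rest c'.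
  rewrite /E (bigD1 k) //= (bigD1 k) //= eqxx w0 add0r.
  rewrite [X in _ + X](eq_bigr (fun i => (if c' i == c' k then w k i else 0) +
     \sum_(j | j != k) (if c' i == c' j then w i j else 0))); last first.
    by move=> i ik; rewrite (bigD1 k) //= wC.
  rewrite big_split /= addrA mulr_natl mulr2n; congr (_ + _ + _).
  by apply: eq_bigr => j _; rewrite eq_sym.
have step t : \sum_(j | c j == c k) w k j <= \sum_(j | c j == t) w k j.
  pose c' := [ffun i => if i == k then t else c i].
  have := cmin c' isT; rewrite !ED (_ : rest c' = rest c); last first.
    apply: eq_bigr => i ik; apply: eq_bigr => j jk.
    by rewrite !ffunE (negbTE ik) (negbTE jk).
  rewrite lerD2r ler_pM2l ?ltr0n //.
  have F s : \sum_(j | c j == s) w k j =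
    \sum_(j | j != k) if c j == s then w k j else 0.
    rewrite big_mkcond (bigD1 k) //= w0; case: ifP; by rewrite add0r.
  rewrite !F => /le_trans; apply.
  rewrite le_eqVlt; apply/orP; left; apply/eqP; apply: eq_bigr => j jk.
  by rewrite !ffunE (negbTE jk) eqxx.
rewrite [leRHS](partition_big c predT) //=.
have -> (x : R) :
  q.+1%:R * x = \sum_(t < q.+1) x by rewrite sumr_const card_ord mulr_natl.
by apply: ler_sum => t _; apply: step.
Qed.

Lemma select_colours N (A : 'M[C]_N) (hA : herm A) (A1 : forall v,
  qf A v <= nsq v) U S z :
  fresh U S -> pos_above (rdet A U S) z ->
  exists T : {set 'I_N}, [/\ S \subset T, pos_above (rdet A [::] T) z &
    forall ab, ab \in U -> (ab.1 \in T) || (ab.2 \in T)].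
Proof.
elim: U S => [|[a b] U IH] S fr pz; first by exists S.
have := fr; rewrite fresh_cons => /and5P[ab aS bS aU /andP[bU fU]].
have [pa|pb] := interlacing hA A1 fr pz.
  have [T [sT pT hT]] := IH _ (fresh_setU1 aU fU) pa.
  exists T; split=> // [|x]; first by apply: fintype.subset_trans sT;
    apply: finset.subsetUr.
  by rewrite inE => /orP[/eqP->|/hT //] /=;
    rewrite (fintype.subsetP sT) ?setU11.
have [T [sT pT hT]] := IH _ (fresh_setU1 bU fU) pb.
exists T; split=> // [|x]; first by apply: fintype.subset_trans sT;
  apply: finset.subsetUr.
by rewrite inE => /orP[/eqP->|/hT //] /=;
  rewrite (fintype.subsetP sT b) ?setU11 ?orbT.
Qed.

Lemma qfE n (A : 'M[C]_n) v :
  qf A v = \sum_i \sum_j Re ((v i 0)^* * A i j * v j 0).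
Proof.
rewrite /qf /hdot Re_sum; apply: eq_bigr => i _.
by rewrite mxE mulr_sumr Re_sum; apply: eq_bigr => j _; rewrite mulrA.
Qed.

Lemma qfZ n (r : R) (A : 'M[C]_n) v : qf (r%:C *: A) v = r * qf A v.
Proof.
rewrite !qfE mulr_sumr; apply: eq_bigr => i _; rewrite mulr_sumr;
  apply: eq_bigr => j _.
by rewrite mxE !(ReM, ImM) /=; ring.
Qed.

Section Key.
Variables (n : nat) (A : 'M[C]_n).
Hypothesis hA : herm A.
Hypothesis A1 : forall v, qf A v <= nsq v.
Hypothesis A0 : forall i, A i i = 0.
Hypothesis Ac : forall c, nsq (col c A) <= 1 / 100.

Let A2 : 'M[C]_(n + n) := block_mx A 0 0 A.

Let hA2 : herm A2.
Proof.
move=> i j; rewrite -(splitK i) -(splitK j).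
case: (fintype.split i) => i'; case: (fintype.split j) => j' /=;
  by rewrite /A2 ?(block_mxEul, block_mxEur, block_mxEdl,
    block_mxEdr) ?mxE ?rmorph0.
Qed.

Let nsq_col (u w : 'cV[C]_n) : nsq (col_mx u w) = nsq u + nsq w.
Proof.
rewrite /nsq big_split_ord /=; congr (_ + _); apply: eq_bigr => i _.
  by rewrite col_mxEu.
by rewrite col_mxEd.
Qed.

Let qf_col (u w : 'cV[C]_n) : qf A2 (col_mx u w) = qf A u + qf A w.
Proof.
rewrite /qf /A2 mul_block_col !mul0mx addr0 add0r -ReD; congr (Re _).
rewrite /hdot big_split_ord /=; congr (_ + _); apply: eq_bigr => i _.
  by rewrite !col_mxEu.
by rewrite !col_mxEd.
Qed.

(** The numbers: at [21 / 20], [resolvent_bound] with [s = 1 / 100] gives at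
    most [500 / 441 <= 5 / 4].  So [phi = 5 / 2], each variable is lowered by
    [phi^-1 / 2 = 1 / 5], and [21 / 20 - 1 / 5 = 17 / 20 <= 9 / 10]. *)
Lemma two_colour : exists S : {set 'I_n}, forall v : 'cV[C]_n,
  (forall i, i \notin S -> v i 0 = 0) \/ (forall i, i \in S -> v i 0 = 0) ->
  qf A v <= 9 / 10 * nsq v.
Proof.
have A21 v : qf A2 v <= nsq v.
  by rewrite -(vsubmxK v) qf_col nsq_col lerD.
pose U := [seq (lshift n k, rshift n k) | k <- enum 'I_n].
have vU : vars U =
  [seq lshift n k | k <- enum 'I_n] ++ [seq rshift n k | k <- enum 'I_n].
  by rewrite /vars /U -!map_comp.
have allU i : i \in vars U.
  rewrite vU mem_cat -(splitK i); case: (fintype.split i) => j /=.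
    by rewrite map_f ?mem_enum.
  by rewrite map_f ?orbT ?mem_enum.
have fU : fresh U finset.set0.
  rewrite /fresh; apply/andP; split; last by apply/allP => i _; rewrite inE.
  rewrite vU cat_uniq (map_inj_uniq (@lshift_inj _ _)) (map_inj_uniq
    (@rshift_inj _ _)).
  rewrite enum_uniq andbT /=; apply/hasPn => _ /mapP[k _ ->];
    apply/mapP => -[j _ /eqP].
  by rewrite eq_sym eq_lrshift.
have TU : finset.set0 :|: [set i in vars U] = [set: 'I_(n + n)].
  by apply/setP => i; rewrite !finset.in_setU !finset.in_set allU orbT.
have c2 c : nsq (col c A2) <= 1 / 100.
  have n0 : nsq (0 : 'cV[C]_n) = 0 by apply: big1 => i _;
    rewrite mxE /= expr0n addr0.
  rewrite -(splitK c); case: (fintype.split c) => j /=; rewrite /A2 block_mxEh.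
    rewrite (_ : col _ _ = col_mx (col j A) 0) ?nsq_col ?n0 ?addr0 //.
    apply/matrixP => i k; rewrite mxE row_mxEl.
    by rewrite -(splitK i); case: (fintype.split i) => l /=;
      rewrite ?col_mxEu ?col_mxEd !mxE.
  rewrite (_ : col _ _ = col_mx 0 (col j A)) ?nsq_col ?n0 ?add0r //.
  apply/matrixP => i k; rewrite mxE row_mxEr.
  by rewrite -(splitK i); case: (fintype.split i) => l /=;
    rewrite ?col_mxEu ?col_mxEd !mxE.
have A20 i : A2 i i = 0.
  rewrite -(splitK i); case: (fintype.split i) => j /=.
    by rewrite /A2 block_mxEul.
  by rewrite /A2 block_mxEdr.
have x1 : 1 < 21 / 20 :> R by lra.
have phi0 : 0 < 5 / 2 :> R by lra.
have [|pos _] := barrier hA2 A21 x1 phi0 fU.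
  move=> c _; rewrite TU; have := resolvent_bound hA2 A21 A20 x1 (c2 c).
  have := @rdet_big _ _ _ hA2 A21 [::] [set: 'I_(n + n)] _ (fun=> x1).
  rewrite (_ : 1 / 100 / (21 / 20 - 1) = 1 / 5 :> R); last by field.
  set d := rdet _ _ _ _; set g := rdet _ _ _ _; lra.
have [T [_ posT hT]] := select_colours hA2 A21 fU pos.
have posT' : pos_above (rdet A2 [::] T) (fun=> 9 / 10).
  move=> y hy; apply: posT => i; apply: le_trans (hy i).
  by rewrite /lowered allU; lra.
have bound := pos_above_form hA2 (ltac:(lra) : 0 < 9 / 10 :> R) posT'.
exists [set k | lshift n k \in T] => v hv.
(* an index of the first copy outside [T] has its twin in [T] *)
have [s [<- <- hs]] : exists s, [/\ qf A2 s = qf A v, nsq s = nsq v &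
    forall i, i \notin T -> s i 0 = 0].
  have q0 : qf A 0 = 0 by rewrite /qf mulmx0 /hdot big1 // => i _;
    rewrite [X in _ * X]mxE mulr0.
  have n0 : nsq (0 : 'cV[C]_n) = 0 by apply: big1 => i _;
    rewrite mxE /= expr0n addr0.
  case: hv => hv; [exists (col_mx v 0) | exists (col_mx 0 v)];
    rewrite qf_col nsq_col q0 n0 ?addr0 ?add0r; split=> // i.
    rewrite -(splitK i); case: (fintype.split i) => j /= jT;
      rewrite ?col_mxEu ?col_mxEd ?mxE //.
    by apply: hv; rewrite inE.
  rewrite -(splitK i); case: (fintype.split i) => j /= jT;
    rewrite ?col_mxEu ?col_mxEd ?mxE //.
  apply: hv; rewrite inE; have := hT (lshift n j, rshift n j).
  by rewrite /= (negbTE jT) orbF; apply; apply/mapP; exists j;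
    rewrite ?mem_enum.
exact: bound.
Qed.

End Key.
End Colouring.

(** * Rounds of paving *)

Section Paving.
Variable R : rcfType.
Local Open Scope complex_scope.
Local Notation C := R[i].
Local Notation Re := (@complex.Re R).
Local Notation Im := (@complex.Im R).

(** The block diagonal part for the partition into the classes of [c], on the
    full index set: successive colourings act on matrices of one size. *)
Definition pinch n (K : eqType) (c : 'I_n -> K) (A : 'M[C]_n) : 'M[C]_n :=
  \matrix_(i, j) if c i == c j then A i j else 0.

Lemma pinch_herm n (K : eqType) (c : 'I_n -> K) A : herm A -> herm (pinch c A).
Proof. by move=> hA i j; rewrite !mxE eq_sym; case: ifP => _;
  rewrite ?rmorph0 //; apply: hA. Qed.

Lemma pinch_diag0 n (K : eqType) (c : 'I_n -> K) (A : 'M[C]_n) :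
  (forall i, A i i = 0) -> forall i, pinch c A i i = 0.
Proof. by move=> A0 i; rewrite mxE eqxx. Qed.

Lemma pinch_pinch n (K L : eqType) (c : 'I_n -> K) (d : 'I_n -> L) (A :
  'M[C]_n) :
  pinch d (pinch c A) = pinch (fun i => (c i, d i)) A.
Proof. by apply/matrixP => i j; rewrite !mxE xpair_eqE andbC;
  do !case: (_ == _). Qed.

Lemma pinch_refine n (K L : eqType) (c : 'I_n -> K) (d : 'I_n -> L) (A :
  'M[C]_n) :
  (forall i j, d i = d j -> c i = c j) -> pinch d A = pinch d (pinch c A).
Proof.
move=> dc; apply/matrixP => i j; rewrite !mxE; case: eqP => // /dc ->.
by rewrite eqxx.
Qed.

Definition form_le n (A : 'M[C]_n) (rho : R) := forall v,
  `|qf A v| <= rho * nsq v.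

Lemma pinch_le n (K : finType) (c : 'I_n -> K) (A : 'M[C]_n) rho :
  (forall k (v : 'cV[C]_n), (forall i,
    c i != k -> v i 0 = 0) -> `|qf A v| <= rho * nsq v) ->
  form_le (pinch c A) rho.
Proof.
move=> H v.
pose m k : 'cV[C]_n := \col_i if c i == k then v i 0 else 0.
have nE : nsq v = \sum_k nsq (m k).
  rewrite /nsq exchange_big; apply: eq_bigr => i _;
    rewrite (bigD1 (c i)) //= mxE eqxx.
  rewrite big1 ?addr0 // => k ki; rewrite mxE eq_sym (negbTE ki) /=.
  by rewrite expr0n addr0.
have qE : qf (pinch c A) v = \sum_k qf A (m k).
  under [RHS]eq_bigr do rewrite qfE.
  rewrite qfE [RHS]exchange_big; apply: eq_bigr => i _;
    rewrite [RHS]exchange_big /=.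
  apply: eq_bigr => j _; rewrite (bigD1 (c i)) //= big1 ?addr0 => [|k ki].
    rewrite !mxE eqxx eq_sym; case: ifP => //.
    by rewrite mulr0 mul0r mulr0.
  by rewrite mxE eq_sym (negbTE ki) rmorph0 !mul0r.
rewrite qE nE mulr_sumr; apply: le_trans (ler_norm_sum _ _ _) _.
by apply: ler_sum => k _; apply: (H k) => i /negbTE ik; rewrite mxE ik.
Qed.

Lemma form_le_pinch n (K : finType) (c : 'I_n -> K) (A : 'M[C]_n) rho :
  form_le A rho -> form_le (pinch c A) rho.
Proof. by move=> h; apply: pinch_le => k v _; apply: h. Qed.

Lemma qf_pinch_supp n (K : eqType) (c : 'I_n -> K) (A : 'M[C]_n) k (v :
  'cV[C]_n) :
  (forall i, c i != k -> v i 0 = 0) -> qf (pinch c A) v = qf A v.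
Proof.
move=> h; rewrite !qfE; apply: eq_bigr => i _; apply: eq_bigr => j _;
  rewrite mxE.
case: (eqVneq (c i) k) => ci; last by rewrite h // rmorph0 !mul0r.
case: (eqVneq (c j) k) => cj; last by rewrite [v j 0]h // !mulr0.
by rewrite ci cj eqxx.
Qed.

Lemma hdotDl n (u v w : 'cV[C]_n) : hdot (u + v) w = hdot u w + hdot v w.
Proof. by rewrite hdotC hdotDr rmorphD /= -!hdotC. Qed.

Lemma hdotZl n (a : C) (u v : 'cV[C]_n) : hdot (a *: u) v = a^* * hdot u v.
Proof. by rewrite hdotC hdotZr rmorphM /= -hdotC. Qed.

Lemma nsqZ n (r : R) (v : 'cV[C]_n) : nsq (r%:C *: v) = r ^+ 2 * nsq v.
Proof.
rewrite /nsq mulr_sumr; apply: eq_bigr => i _.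
by rewrite mxE ReM ImM /=; ring.
Qed.

(** Polarization expresses [Re <u, B v>] by the forms at [v + u], [v - u],
    [v + 'i u] and [v - 'i u]; take [u] to be [B v] divided by [w1 + w2]. *)
Lemma numerical_radius_bound n (B : 'M[C]_n) (w1 w2 : R) :
  0 <= w1 -> 0 <= w2 -> 0 < w1 + w2 ->
  (forall v, `|Re (hdot v (B *m v))| <= w1 * nsq v) ->
  (forall v, `|Im (hdot v (B *m v))| <= w2 * nsq v) ->
  forall v, nsq (B *m v) <= (w1 + w2) ^+ 2 * nsq v.
Proof.
move=> w10 w20 w0 h1 h2 v; set w := w1 + w2 in w0 *.
have [u uE] : exists u, u = (w^-1)%:C *: (B *m v) by eexists.
pose sc (a : C) := v + a *: u.
have nE a : nsq (sc a) = nsq v + 2 * Re (a * hdot v u) + sqn a * nsq u.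
  have : hdot (sc a) (sc a) =
      hdot v v + a * hdot v u + (a * hdot v u)^* + a^* * a * hdot u u.
    rewrite /sc !(hdotDl, hdotDr, hdotZl, hdotZr) (hdotC v u) rmorphM /=; ring.
  by rewrite !hdot_self sqnE => /(congr1 Re); rewrite !(ReD, ReM, ReJ) /=; lra.
have QE a : hdot (sc a) (B *m sc a) =
    hdot v (B *m v) + a * hdot v (B *m u) + a^* * hdot u (B *m v) + a^* * a *
      hdot u (B *m u).
  rewrite /sc mulmxDr -scalemxAr !(hdotDl, hdotDr, hdotZl, hdotZr); ring.
have := h1 (sc 1); have := h1 (sc (- 1)); have := h2 (sc 'i);
  have := h2 (sc (- 'i)).
rewrite !nE !QE !ler_norml => /andP[_ e1] /andP[e2 _] /andP[e3 _] /andP[_ e4].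
move: e1 e2 e3 e4; rewrite !(ReD, ImD, ReM, ImM) /sqn /=.
have uB : Re (hdot u (B *m v)) = w^-1 * nsq (B *m v).
  by rewrite uE hdotZl hdot_self ReM ReJ /= mulr0 subr0.
have nu : nsq u = (w^-1) ^+ 2 * nsq (B *m v).
  by rewrite uE nsqZ.
move: uB nu; case: (hdot u (B *m v)) => a1 b1; case: (hdot v (B *m u)) => a2 b2.
case: (hdot v (B *m v)) => a3 b3; case: (hdot u (B *m u)) => a4 b4.
case: (hdot v u) => a5 b5 /= -> ->.
move: (nsq (B *m v)) (nsq v) => X Y.
have wX : w^-1 * X = w * (w^-1 ^+ 2 * X) by field; rewrite gt_eqF.
rewrite wX; set Z := w^-1 ^+ 2 * X.
have -> : X = w ^+ 2 * Z by rewrite /Z; field; rewrite gt_eqF.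
rewrite /w => e1 e2 e3 e4.
have : (w1 + w2) * Z <= (w1 + w2) * Y.
  by lra.
by rewrite !ler_pM2l // ?exprn_gt0.
Qed.

Lemma col_bound n (A : 'M[C]_n) rho c : herm A -> 0 < rho -> form_le A rho ->
  nsq (col c A) <= rho ^+ 2.
Proof.
move=> hA r0 fA; rewrite colE;
  apply: le_trans (@numerical_radius_bound _ A rho 0 _ _ _ _ _ _) _ => //.
- exact: ltW.
- by rewrite addr0.
- by move=> v; rewrite qf_real // normr0 mul0r.
rewrite addr0 (_ : nsq _ = 1) ?mulr1 // /nsq (bigD1 c) //= big1 => [|i ic].
  by rewrite mxE !eqxx /=; ring.
by rewrite mxE (negbTE ic) /=; ring.
Qed.

(** The colour of [i] records its class in an unfriendly 100-colouring and its
    colours in the two-colourings of the pinched matrix and of its opposite, all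
    scaled by [rho]. *)
Lemma paving_round n (A : 'M[C]_n) rho : herm A -> (forall i,
  A i i = 0) -> 0 < rho ->
  form_le A rho -> exists c : 'I_n -> 'I_100 * (bool * bool),
  form_le (pinch c A) (9 / 10 * rho).
Proof.
move=> hA A0 r0 fA.
have [||c0 hc0] := @unfriendly_colouring _ n 99 (fun i j => sqn (A i j)).
- by move=> i j; rewrite [A i j]hA /sqn ReJ ImJ sqrrN.
- by move=> i; rewrite A0 /sqn /= expr0n addr0.
pose B := pinch c0 A; pose B1 (s : R) := (s / rho)%:C *: B.
have hB : herm B by apply: pinch_herm.
have fB : form_le B rho by apply: form_le_pinch.
have key s : s ^+ 2 = 1 -> exists S : {set 'I_n}, forall v : 'cV[C]_n,
  (forall i, i \notin S -> v i 0 = 0) \/ (forall i, i \in S -> v i 0 = 0) ->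
  s * qf B v <= 9 / 10 * rho * nsq v.
  move=> s1; have [||||S hS] := @two_colour _ n (B1 s).
  - move=> i j; rewrite [LHS]mxE [in RHS]mxE (hB i j); case: (B i j) => a b.
    by apply: eqC => /=; ring.
  - move=> v; rewrite qfZ mulrAC ler_pdivrMr //.
    have /eqP := s1; rewrite sqrf_eq1 => /orP[] /eqP ->; have := fB v;
      rewrite ler_norml; lra.
  - by move=> i; rewrite mxE pinch_diag0 ?mulr0.
  - move=> k; rewrite (_ : col k _ = (s / rho)%:C *: col k B); last first.
      by apply/matrixP => i j; rewrite !mxE.
    rewrite nsqZ expr_div_n s1 mulrAC ler_pdivrMr ?exprn_gt0 // mul1r.
    have := col_bound k hA r0 fA; have := hc0 k.
    have -> : nsq (col k A) = \sum_j sqn (A k j).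
      by apply: eq_bigr => j _; rewrite mxE hA /sqn ReJ ImJ sqrrN.
    have -> : nsq (col k B) = \sum_(j | c0 j == c0 k) sqn (A k j).
      rewrite [RHS]big_mkcond; apply: eq_bigr => j _; rewrite !mxE.
      by case: ifP => _; rewrite /= ?expr0n ?addr0 // hA /sqn ReJ ImJ sqrrN.
    by lra.
  exists S => v /hS; rewrite qfZ mulrAC ler_pdivrMr //; lra.
have [S1 h1] := key 1 (expr1n _ _);
  have [S2 h2] := key (- 1) ltac:(by rewrite sqrrN expr1n).
exists (fun i => (c0 i, (i \in S1, i \in S2)));
  apply: pinch_le => -[k [b1 b2]] v hv.
rewrite -(@qf_pinch_supp _ _ c0 A k v); last first.
  by move=> i ik; apply: hv; rewrite xpair_eqE negb_and ik.
have supp (S : {set 'I_n}) b : (forall i, (i \in S) != b -> v i 0 = 0) ->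
  (forall i, i \notin S -> v i 0 = 0) \/ (forall i, i \in S -> v i 0 = 0).
  case: b => hb; [left|right] => i iS; apply: hb; first by rewrite eqb_id.
  by rewrite iS.
have := h1 v (supp S1 b1 _); have := h2 v (supp S2 b2 _).
rewrite ler_norml => e2 e1; apply/andP; split.
  by have := e2 ltac:(by move=> i ib; apply: hv;
    rewrite !xpair_eqE !negb_and ib !orbT); lra.
by have := e1 ltac:(by move=> i ib; apply: hv;
  rewrite !xpair_eqE !negb_and ib !orbT); lra.
Qed.

Lemma paving_rounds t n (A : 'M[C]_n) rho : herm A -> (forall i,
  A i i = 0) -> 0 < rho ->
  form_le A rho -> exists (K : finType) (c : 'I_n -> K),
  #|K| = (400 ^ t)%N /\ form_le (pinch c A) ((9 / 10) ^+ t * rho).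
Proof.
move=> hA A0 r0 fA; elim: t => [|t [K [c [cK fc]]]].
  exists unit, (fun=> tt); rewrite card_unit; split=> //.
  by rewrite expr0 mul1r; apply: form_le_pinch.
have [|c' hc'] := @paving_round n (pinch c A) _ (pinch_herm c hA)
  (pinch_diag0 c A0) _ fc.
  by rewrite mulr_gt0 // exprn_gt0 //; lra.
exists (K * ('I_100 * (bool * bool)))%type, (fun i => (c i, c' i)).
rewrite !card_prod cK card_ord card_bool expnS mulnC; split=> //.
by rewrite -pinch_pinch exprS -mulrA.
Qed.

End Paving.

(** * Partitions with a prescribed number of blocks *)

Section Refinement.

(** While fewer than [m] colours occur, two points share a colour, and one of
    them can be given a new colour, [None]. *)
Lemma refine_colouring (T K : finType) (c : T -> K) m :
  (#|c @: [set: T]| <= m <= #|T|)%N ->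
  exists (L : finType) (d : T -> L), #|d @: [set: T]| = m /\
    forall x y, d x = d y -> c x = c y.
Proof.
move=> /andP[cm mT]; have [k] := ubnP (m - #|c @: [set: T]|).
elim: k K c cm => // k IH K c cm lk.
have [<-|cmn] := eqVneq #|c @: [set: T]| m; first by exists K, c.
have lt_cm : (#|c @: [set: T]| < m)%N by rewrite ltn_neqAle cmn.
have /injectivePn[x [y xy cxy]] : ~~ injectiveb c.
  apply: contraL (leq_trans lt_cm mT) => /injectiveP ci.
  by rewrite -leqNgt card_imset // cardsT.
pose d i := if i == x then None else Some (c i).
have dE : d @: [set: T] = None |: Some @: (c @: [set: T]).
  apply/setP => -[l|]; rewrite !inE /=; last first.
    by apply/imsetP; exists x; rewrite ?inE // /d eqxx.
  rewrite (mem_imset _ _ (@Some_inj _)).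
  apply/imsetP/imsetP => [[i _]|[i _ ->]].
    by rewrite /d; case: ifP => // _ [->]; exists i.
  have [->|ix] := eqVneq i x; last by exists i; rewrite /d ?(negbTE ix).
  by exists y; rewrite /d 1?eq_sym ?(negbTE xy) -?cxy.
have dc : #|d @: [set: T]| = (#|c @: [set: T]|).+1.
  rewrite dE cardsU1 card_imset; last exact: Some_inj.
  by rewrite (_ : None \notin _) // ; apply/imsetP => -[].
have [||L [e [eL ed]]] := IH _ d; rewrite ?dc //.
  by rewrite subnS -ltnS prednK // subn_gt0.
exists L, e; split=> // i j /ed; rewrite /d.
case: eqVneq => [->|ix]; case: eqVneq => [->|jx] //.
by case.
Qed.

Lemma card_preim_partition (T K : finType) (c : T -> K) :
  #|preim_partition c [set: T]| = #|c @: [set: T]|.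
Proof.
rewrite /preim_partition /equivalence_partition.
rewrite (_ : [set _ | x in _] =
  (fun k => [set y in [set: T] | k == c y]) @: (c @: [set: T])).
  rewrite card_in_imset // => _ _ /imsetP[x _ ->] /imsetP[y _ ->] /setP/(_ x).
  by rewrite !inE /= eqxx => /esym/eqP ->.
by rewrite -imset_comp; apply: eq_imset.
Qed.

End Refinement.

(** * Paving a contraction *)

Section HalfPave.
Variable R : rcfType.
Local Open Scope complex_scope.
Local Notation C := R[i].
Local Notation Re := (@complex.Re R).
Local Notation Im := (@complex.Im R).
Local Notation normc := ComplexField.Normc.normc.

(** The Hermitian part; that of [- 'i *: B] carries the imaginary part of the
    form of [B]. *)
Definition hpart n (B : 'M[C]_n) : 'M[C]_n := \matrix_(i,
  j) ((B i j + (B j i)^*) / 2%:R).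

Definition offdiag n (B : 'M[C]_n) : 'M[C]_n := \matrix_(i,
  j) if i == j then 0 else B i j.

Lemma half2 (x : C) : x / 2%:R = (Re x / 2) +i* (Im x / 2).
Proof.
have -> : x = (Re x / 2 +i* (Im x / 2)) * 2%:R.
  by rewrite mulr_natr mulr2n; apply: eqC => /=; field.
rewrite mulfK ?pnatr_eq0 //=.
rewrite -[2%:R]/((1 + 1)%R) mulrDr mulr1 /=.
by apply: eqC => /=; field.
Qed.

Lemma hpart_herm n (B : 'M[C]_n) : herm (hpart B).
Proof.
move=> i j; rewrite !mxE !half2; case: (B i j) => a b; case: (B j i) => c d.
by apply: eqC => /=; field.
Qed.

Lemma qf_hpart n (B : 'M[C]_n) v : qf (hpart B) v = qf B v.
Proof.
have E : qf B v = \sum_i \sum_j Re ((v i 0)^* * (B j i)^* * v j 0).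
  rewrite qfE exchange_big; apply: eq_bigr => i _; apply: eq_bigr => j _.
  by rewrite !(ReM, ImM, ReJ, ImJ); ring.
have : qf (hpart B) v = (qf B v + qf B v) / 2.
  rewrite {2}E !qfE -big_split mulr_suml; apply: eq_bigr => i _.
  rewrite -big_split mulr_suml; apply: eq_bigr => j _.
  by rewrite mxE half2 /= !(ReM, ImM, ReD, ImD, ReJ, ImJ) /=; field.
by move=> ->; field.
Qed.

Lemma pinch_hpart n (K : eqType) (c : 'I_n -> K) (B : 'M[C]_n) :
  pinch c (hpart B) = hpart (pinch c B).
Proof.
apply/matrixP => i j; rewrite !mxE eq_sym; case: ifP => // _.
by rewrite rmorph0 addr0 mul0r.
Qed.

Lemma pinch_offdiag n (K : eqType) (c : 'I_n -> K) (B : 'M[C]_n) :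
  pinch c (offdiag B) = offdiag (pinch c B).
Proof. by apply/matrixP => i j; rewrite !mxE; do !case: ifP. Qed.

Lemma qf_offdiag n (B : 'M[C]_n) v (mu : R) : (forall i, `|Re (B i i)| <= mu) ->
  `|qf B v - qf (offdiag B) v| <= mu * nsq v.
Proof.
move=> hmu; rewrite !qfE -sumrB mulr_sumr.
apply: le_trans (ler_norm_sum _ _ _) _; apply: ler_sum => i _.
rewrite -sumrB (bigD1 i) //= big1 ?addr0 => [|j ji]; last first.
  by rewrite mxE eq_sym (negbTE ji) subrr.
rewrite mxE eqxx mulr0 mul0r subr0.
have -> : Re ((v i 0)^* * B i i * v i 0) = Re (B i i) * sqn (v i 0).
  by rewrite !(ReM, ImM, ReJ, ImJ) /sqn; ring.
by rewrite normrM (ger0_norm (sqn_ge0 _)) ler_wpM2r ?sqn_ge0.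
Qed.

(** Stated for every refinement [d] of the colouring [c], because the
    colourings for the Hermitian and the anti-Hermitian part are to be
    combined, and the result then cut into the prescribed number of blocks. *)
Lemma pave_form n (B : 'M[C]_n) mu t : form_le B 1 ->
  (forall i, `|Re (B i i)| <= mu) -> mu <= 1 ->
  exists (K : finType) (c : 'I_n -> K), #|K| = (400 ^ t)%N /\
    forall (L : finType) (d : 'I_n -> L), (forall i j,
      d i = d j -> c i = c j) ->
    form_le (pinch d B) (2 * (9 / 10) ^+ t + mu).
Proof.
move=> fB hmu mu1; pose H := hpart (offdiag B).
have H0 i : H i i = 0 by rewrite !mxE eqxx rmorph0 addr0 mul0r.
have fH : form_le H 2.
  move=> v; rewrite qf_hpart; have := fB v; have := qf_offdiag v hmu.
  have := ler_wpM2r (nsq_ge0 v) mu1; rewrite !ler_norml.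
  by move=> h /andP[h1 h2] /andP[h3 h4]; apply/andP; split; lra.
have [|K [c [cK fc]]] := paving_rounds t (@hpart_herm _ _) H0 _ fH;
  first by lra.
exists K, c; split=> // L d dc v.
have hmud i : `|Re (pinch d B i i)| <= mu by rewrite mxE eqxx.
have := qf_offdiag v hmud.
have := form_le_pinch d fc v;
  rewrite -pinch_refine // pinch_hpart pinch_offdiag qf_hpart.
rewrite !ler_norml => /andP[h1 h2] /andP[h3 h4]; apply/andP; split; lra.
Qed.

Lemma pinchZ n (K : eqType) (c : 'I_n -> K) (a : C) (B : 'M[C]_n) :
  pinch c (a *: B) = a *: pinch c B.
Proof. by apply/matrixP => i j; rewrite !mxE; case: ifP; rewrite ?mulr0. Qed.

Lemma hdot_bound n (u v : 'cV[C]_n) : nsq u <= nsq v ->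
  `|Re (hdot v u)| <= nsq v /\ `|Im (hdot v u)| <= nsq v.
Proof.
move=> uv; have h : (nsq v + nsq u) / 2 <= nsq v by lra.
split; apply: le_trans h;
  rewrite /hdot ?Re_sum ?Im_sum /nsq -big_split mulr_suml;
  apply: le_trans (ler_norm_sum _ _ _) _; apply: ler_sum => i _;
  case: (v i 0) => a b; case: (u i 0) => p q /=; rewrite ler_norml;
    apply/andP; split;
  have := sqr_ge0 (a - p); have := sqr_ge0 (a + p); have := sqr_ge0 (b - q);
  have := sqr_ge0 (b + q); have := sqr_ge0 (a - q); have := sqr_ge0 (a + q);
  have := sqr_ge0 (b - p); have := sqr_ge0 (b + p); lra.
Qed.

Lemma pave_contraction n (A : 'M[C]_n) mu t : (forall v,
  nsq (A *m v) <= nsq v) ->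
  (forall i, normc (A i i) <= mu) -> 0 <= mu -> mu <= 1 ->
  exists (K : finType) (c : 'I_n -> K), #|K| = (400 ^ (2 * t))%N /\
    forall (L : finType) (d : 'I_n -> L), (forall i j,
      d i = d j -> c i = c j) ->
    forall v, nsq (pinch d A *m v) <= (4 * (9 / 10) ^+ t + 2 * mu) ^+ 2 * nsq v.
Proof.
move=> cA hmu mu0 mu1.
have nRe (x : C) : `|Re x| <= normc x.
  by case: x => a b;
    rewrite /normc /= -sqrtr_sqr ler_sqrt ?lerDl ?sqr_ge0 // addr_ge0 ?sqr_ge0.
have nIm (x : C) : `|Im x| <= normc x.
  by case: x => a b;
    rewrite /normc /= -sqrtr_sqr ler_sqrt ?lerDr ?sqr_ge0 // addr_ge0 ?sqr_ge0.
have qI (B : 'M[C]_n) v : qf ((- 'i) *: B) v = Im (hdot v (B *m v)).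
  by rewrite /qf -scalemxAl hdotZr ReM /=; ring.
have f1 : form_le A 1 by move=> v; rewrite mul1r; have [] := hdot_bound (cA v).
have f2 : form_le ((- 'i) *: A) 1.
  by move=> v; rewrite mul1r qI; have [] := hdot_bound (cA v).
have [|K1 [c1 [k1 h1]]] := @pave_form _ A mu t f1 _ mu1.
  by move=> i; apply: le_trans (hmu i).
have [|K2 [c2 [k2 h2]]] := @pave_form _ ((- 'i) *: A) mu t f2 _ mu1.
  by move=> i; apply: le_trans (hmu i);
    rewrite mxE ReM /= oppr0 mul0r sub0r mulN1r opprK.
exists (K1 * K2)%type, (fun i => (c1 i, c2 i)); split.
  by rewrite card_prod k1 k2 -expnD mul2n addnn.
move=> L d dc.
have p0 : 0 < (9 / 10) ^+ t :> R by rewrite exprn_gt0 //; lra.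
rewrite (_ : 4 * _ + _ =
  (2 * (9 / 10) ^+ t + mu) + (2 * (9 / 10) ^+ t + mu)); last by ring.
apply: numerical_radius_bound; try lra.
  by apply: h1 => x y /dc [].
by move=> v; rewrite -qI -pinchZ; apply: h2 => x y /dc [].
Qed.

End HalfPave.

(** * The spectral norm and the choice of constants *)

Section Final.
Variable R : realType.
Local Open Scope complex_scope.
Local Notation C := R[i].
Local Notation normc := (@ComplexField.Normc.normc R).

Lemma normc2 (x : C) : normc x ^+ 2 = sqn x.
Proof. by case: x => a b;
  rewrite /normc /sqn sqr_sqrtr //= addr_ge0 ?sqr_ge0. Qed.

Lemma l2normE n (v : 'cV[C]_n) : l2norm v = Num.sqrt (nsq v).
Proof. by rewrite /l2norm; congr Num.sqrt; apply: eq_bigr => i _;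
  rewrite normc2. Qed.

(** A set without supremum has [sup] equal to 0, so the value 1 shows that
    the set of norms is bounded. *)
Lemma specnorm_contraction n (A : 'M[C]_n) : specnorm A = 1 ->
  forall v, nsq (A *m v) <= nsq v.
Proof.
rewrite /specnorm; set E := image _ _ => A1 v.
have hE : has_sup E.
  by apply: contrapT => /sup_out; rewrite A1 => /eqP; rewrite oner_eq0.
have ub x : nsq x <= 1 -> nsq (A *m x) <= 1.
  move=> x1; have : l2norm (A *m x) <= 1.
    rewrite -A1; apply: ub_le_sup; first by case: hE.
    by exists x => //=; rewrite l2normE -sqrtr1 ler_wsqrtr.
  by rewrite l2normE -[leRHS]sqrtr1 ler_sqrt.
have [v0|vn0] := eqVneq (nsq v) 0.
  by rewrite (nsq_eq0 v0) mulmx0.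
have vp : 0 < nsq v by rewrite lt_neqAle eq_sym vn0 nsq_ge0.
pose r := (Num.sqrt (nsq v))^-1.
have r2 : r ^+ 2 = (nsq v)^-1 by rewrite exprVn sqr_sqrtr // ltW.
have := ub (r%:C *: v); rewrite -scalemxAr !nsqZ r2 mulVf // lexx => /(_ isT).
by rewrite mulrC ler_pdivrMr // mul1r.
Qed.

Lemma specnorm_le n (B : 'M[C]_n) (w : R) : 0 <= w ->
  (forall v, nsq (B *m v) <= w ^+ 2 * nsq v) -> specnorm B <= w.
Proof.
move=> w0 h; apply: ge_sup.
  exists (l2norm (B *m 0)); exists 0 => //=.
  rewrite l2normE (_ : nsq _ = 0) ?sqrtr0 //; apply: big1 => i _.
  by rewrite mxE /= expr0n addr0.
move=> _ [x /= x1 <-];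
  rewrite l2normE -[leRHS]ger0_norm // -sqrtr_sqr ler_wsqrtr //.
apply: le_trans (h x) _; rewrite ler_piMr ?sqr_ge0 //.
by move: x1; rewrite l2normE -[leRHS]sqrtr1 ler_sqrt.
Qed.

Lemma blockdiag_pinch n (P : {set {set 'I_n}}) (A : 'M[C]_n) :
  finset.partition P [set: 'I_n] ->
  \sum_(s in P) coordproj R n s *m A *m coordproj R n s =
    pinch (finset.pblock P) A.
Proof.
move=> pP; have [/eqP cP tP _] := and3P pP.
have inP i : finset.pblock P i \in P by apply: pblock_mem;
  rewrite cP finset.in_setT.
have inb i : i \in finset.pblock P i by rewrite mem_pblock cP finset.in_setT.
apply/matrixP => i j; rewrite summxE mxE.
have E s : (coordproj R n s *m A *m coordproj R n s) i j =
   (i \in s)%:R * A i j * (j \in s)%:R.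
  by rewrite /coordproj mul_mx_diag mul_diag_mx !mxE.
under eq_bigr do rewrite E.
rewrite (bigD1 (finset.pblock P i)) //= big1 => [|s /andP[sP si]].
  rewrite addr0 inb mul1r eq_pblock ?cP ?finset.in_setT //.
  by case: ifP; rewrite ?mulr1 ?mulr0.
rewrite (_ : i \in s = false) ?mul0r //; apply: contraNF si => si.
by rewrite (def_pblock tP sP si).
Qed.

End Final.

Theorem theorem2 (R : realType) :
  exists C : R, 0 < C /\
  forall gamma eps : R, 0 < gamma -> 0 < eps -> eps < 1 ->
  exists m N : nat,
    [/\ (0 < m)%N,
        m%:R <= C * eps `^ (- (C / Num.min 1 gamma)) &
        forall n : nat, (N <= n)%N ->
        forall A : 'M[R[i]]_n,
          specnorm A = 1 ->
          (forall j k : 'I_n,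
             ComplexField.Normc.normc (A j k) <= 1 / (ln n%:R) `^ (1 + gamma)) ->
          exists P : {set {set 'I_n}},
            [/\ finset.partition P [set: 'I_n],
                #|P| = m &
                specnorm (\sum_(s in P) coordproj R n s *m A *m coordproj R n s)
                  <= eps]].
Proof.
have base_gt1 : 1 <= 9 :> R by lra.
(* 126 = 2 * 9 * 7: [400 <= 2 ^ 9] and [(9 / 10) ^ 7 <= 1 / 2], and a round is
   counted twice, for the Hermitian and the anti-Hermitian part *)
exists (9 ^+ 126); split=> [|gamma eps g0 e0 e1]; first by rewrite exprn_gt0.
have q0 : 0 < 9 / 10 :> R by lra.
have q1 : 9 / 10 < 1 :> R by lra.
have ex : exists t, (9 / 10) ^+ t <= eps / 8.
  (* Bernoulli's inequality for [10 / 9] *)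
  have bern t : (9 / 10) ^+ t * (1 + t%:R / 9) <= 1 :> R.
    elim: t => [|t IH]; first by rewrite expr0; lra.
    apply: le_trans IH;
      rewrite exprSr -mulrA ler_pM2l ?exprn_gt0 // -[t.+1%:R]natr1.
    by have := ler0n R t; lra.
  exists (Num.bound (72 / eps)); have := bern (Num.bound (72 / eps)).
  have b0 : 0 <= 72 / eps by rewrite divr_ge0 // ltW.
  have := archi_boundP b0.
  move: (Num.bound _) => t; rewrite ltr_pdivrMr // => h1 h2.
  have p : 0 < (9 / 10) ^+ t :> R by rewrite exprn_gt0.
  have := ler_wpM2r (ltW e0) h2; have := ler_wpM2l (ltW p) (ltW h1).
  by have := mulr_gt0 p e0; lra.
have := ex_minnP ex; case=> t ht tmin.
(* [t] is minimal, so [(9 / 10) ^ t] is also not much smaller than [eps] *)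
have t_large : eps / 9 <= (9 / 10) ^+ t.
  case: t ht tmin => [|t] ht tmin; first by rewrite expr0; lra.
  have : eps / 8 < (9 / 10) ^+ t.
    by rewrite ltNge; apply/negP => /tmin; rewrite ltnn.
  by rewrite exprS; lra.
pose m := (400 ^ (2 * t))%N.
exists m, (maxn m (Num.bound (expR (4 / eps)))); split.
- by rewrite expn_gt0.
- rewrite -/m; have mt : m%:R * ((9 / 10) ^+ t) ^+ 126 <= 1 :> R.
    rewrite /m natrX -exprM (_ : (t * 126 = 63 * (2 * t))%N);
      last by rewrite mulnA mulnC.
    rewrite [(9 / 10) ^+ _]exprM -exprMn exprn_ile1 ?mulr_ge0 ?exprn_ge0
      ?ler0n ?ltW //.
    have h7 : (9 / 10) ^+ 7 <= 1 / 2 :> R by lra.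
    have h63 : ((9 / 10) ^+ 7) ^+ 9 <= (1 / 2) ^+ 9 :> R.
      by rewrite lerXn2r ?nnegrE ?exprn_ge0 ?ltW //; lra.
    by rewrite -exprM in h63; move: h63; set a := _ ^+ _; lra.
  have c0 : 0 < eps / 9 by rewrite divr_gt0.
  have : m%:R <= 9 ^+ 126 * eps ^- 126.
    have : m%:R * (eps / 9) ^+ 126 <= 1.
      apply: le_trans mt; apply: ler_wpM2l; first exact: ler0n.
      by apply: lerXn2r => //; rewrite nnegrE ltW // exprn_gt0.
    by rewrite -ler_pdivlMr ?exprn_gt0 // mul1r expr_div_n invf_div.
  move=> /le_trans; apply; rewrite ler_pM2l ?exprn_gt0 //.
  rewrite -(powR_mulrn 126 (ltW e0)) -powRN; apply: ger_powR;
    first by rewrite e0 ltW.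
  rewrite lerN2; have min0 : 0 < Num.min 1 gamma by rewrite lt_min ltr01.
  rewrite ler_pdivlMr //; apply: le_trans (_ : 126%:R * 1 <= _).
    by rewrite ler_wpM2l ?ler0n // ge_min lexx.
  rewrite mulr1; apply: le_trans (_ : 9 ^+ 3 <= _); first by lra.
  by rewrite ler_weXn2l.
move=> n; rewrite geq_max => /andP[mn Nn] A A1 hA.
pose mu := eps / 4.
have en : expR (4 / eps) <= n%:R.
  apply/ltW/(lt_le_trans (archi_boundP _)); first exact: expR_ge0.
  by rewrite ler_nat.
have n0 : 0 < n%:R :> R by apply: lt_le_trans en; apply: expR_gt0.
have ln4 : 4 / eps <= ln n%:R by rewrite -[leLHS]expRK ler_ln ?posrE ?expR_gt0.
have ln1 : 1 <= ln (n%:R : R).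
  by apply: le_trans ln4; rewrite ler_pdivlMr //; lra.
have hmu i : ComplexField.Normc.normc (A i i) <= mu.
  apply: le_trans (hA i i) _; rewrite /mu.
  have h : 4 / eps <= ln n%:R `^ (1 + gamma).
    apply: le_trans ln4 _; rewrite -[leLHS]powRr1; last by lra.
    by apply: ler_powR => //; lra.
  have h0 : 0 < 4 / eps by rewrite divr_gt0.
  rewrite -[leRHS]invrK invf_div div1r lef_pV2 ?posrE //.
  exact: lt_le_trans h0 h.
have [||K [c [cK hc]]] := pave_contraction t (specnorm_contraction A1) hmu.
- by rewrite /mu; lra.
- by rewrite /mu; lra.
have [|L [d [dm dc]]] := @refine_colouring _ _ c m.
  by rewrite card_ord mn andbT /m -cK max_card.
pose P := preim_partition d [set: 'I_n].
have pP : finset.partition P [set: 'I_n] by apply: preim_partitionP.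
exists P; split=> //; first by rewrite card_preim_partition.
rewrite blockdiag_pinch //.
apply: le_trans (specnorm_le (w := 4 * (9 / 10) ^+ t + 2 * mu) _ _) _.
- by rewrite addr_ge0 ?mulr_ge0 ?exprn_ge0 ?ltW // /mu; lra.
- move=> v; apply: hc => i j; rewrite /P => ij; apply: dc.
  have : j \in finset.pblock P i.
    rewrite /P ij mem_pblock; case/and3P: pP => /eqP -> _ _;
      exact: finset.in_setT.
  rewrite pblock_equivalence_partition ?inE //; last by split=> // /eqP->.
  by move=> /eqP.
- by rewrite /mu; lra.
Qed.
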